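(* Let $R>1$, let $d\ge 1$ be an integer, and let $A\in\mathbb{C}^{d\times d}$ be an invertible matrix satisfying $w(A)<R$ and $w(A^{-1})<R$. Then $$K(A,R)\;\le\; 2+\sqrt{4+\frac{2}{R^2+1}}.$$
   Context: For $R>1$, let $\mathcal{A}_R=\{z\in\mathbb{C} : R^{-1}<|z|<R\}$ be the open annulus. $\mathbb{C}^d$ carries the Euclidean inner product $\langle\cdot,\cdot\rangle$ and its norm $\|\cdot\|$; for a matrix $A\in\mathbb{C}^{d\times d}$, $\|A\|=\max\{\|Au\| : u\in\mathbb{C}^d,\ \|u\|\le 1\}$ is the operator norm and $w(A)=\max\{|\langle Au,u\rangle| : u\in\mathbb{C}^d,\ \|u\|\le 1\}$ is the numerical radius. For a matrix $A$ whose spectrum is contained in $\mathcal{A}_R$, $K(A,R)$ denotes the smallest constant $K$ such that $\|f(A)\|\le K$ for all rational functions $f$ bounded by $1$ in $\mathcal{A}_R$ (that is, $|f(z)|\le 1$ for all $z\in\mathcal{A}_R$). The hypotheses $w(A)<R$ and $w(A^{-1})<R$ imply that the spectrum of $A$ is contained in $\mathcal{A}_R$. *)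

(* Defs.v *)
From HB Require Import structures.
From mathcomp Require Import all_boot all_order all_algebra.
From mathcomp Require Import spectral complex.
From mathcomp Require Import all_classical all_reals.
From mathcomp Require Import ereal.

Set Implicit Arguments.
Unset Strict Implicit.
Unset Printing Implicit Defensive.

Import Order.TTheory GRing.Theory Num.Theory.
Import Normc.

Local Open Scope ring_scope.
Local Open Scope classical_set_scope.

Definition annulus (R : realType) (rho : R) : set R[i] :=
  [set z | rho^-1 < normc z < rho].

(* [dotmx] is defined on row vectors and is linear in its first argument. *)
Definition inner (R : realType) (d : nat) (u v : 'cV[R[i]]_d) : R[i] :=
  dotmx u^T v^T.

(* [inner u u] is a nonnegative real, so taking its real part loses nothing. *)
Definition vnorm (R : realType) (d : nat) (u : 'cV[R[i]]_d) : R :=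
  Num.sqrt (complex.Re (inner u u)).

(* In [opnorm] and [numradius] the suprema are maxima: the functions are
   continuous and the unit ball of C^d is compact. *)
Definition opnorm (R : realType) (d : nat) (A : 'M[R[i]]_d) : R :=
  sup [set vnorm (A *m u) | u in [set u : 'cV[R[i]]_d | vnorm u <= 1]].

Definition numradius (R : realType) (d : nat) (A : 'M[R[i]]_d) : R :=
  sup [set normc (inner (A *m u) u) | u in [set u : 'cV[R[i]]_d | vnorm u <= 1]].

(* A rational function regular on the annulus is represented by a pair (p, q)
   of polynomials, standing for p / q, where q has no zero in the annulus.
   The reduced form of any such function is of this kind, and the values p / q
   on the annulus and at a matrix with spectrum in the annulus do not depend
   on the representation.  The condition on q cannot be dropped, as division
   by 0 yields 0. *)
Definition bounded_by_one_on_annulus (R : realType) (rho : R)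
    (p q : {poly R[i]}) : Prop :=
  forall z, annulus rho z -> q.[z] != 0 /\ normc (p.[z] / q.[z]) <= 1.

Definition ratfun_mx (R : realType) (d : nat) (p q : {poly R[i]})
    (A : 'M[R[i]]_d.+1) : 'M[R[i]]_d.+1 :=
  horner_mx A p *m invmx (horner_mx A q).

Definition is_spectral_constant (R : realType) (d : nat)
    (A : 'M[R[i]]_d.+1) (rho K : R) : Prop :=
  forall p q : {poly R[i]}, bounded_by_one_on_annulus rho p q ->
    opnorm (ratfun_mx p q A) <= K.

(* K(A, rho), meaningful when the spectrum of A lies in the annulus (otherwise
   [invmx] may be applied to a singular matrix).  The set of admissible
   constants is closed and bounded below, so the infimum is its least element
   when it is nonempty; it is +oo when there is no admissible constant, so an
   upper bound on it does assert the existence of one. *)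
Definition Kconst (R : realType) (d : nat) (A : 'M[R[i]]_d.+1) (rho : R) :
    \bar R :=
  ereal_inf (EFin @` [set K : R | is_spectral_constant A rho K]).

(* Main.v *)
Require Import Defs.
From HB Require Import structures.
From mathcomp Require Import all_boot all_order all_algebra.
From mathcomp Require Import spectral complex.
From mathcomp Require Import all_classical all_reals.
From mathcomp Require Import ereal.
From mathcomp Require Import cyclic separable cyclotomic.
From mathcomp Require Import ring lra zify.

Import Order.TTheory GRing.Theory Num.Theory.

Local Open Scope ring_scope.

(** Choose a radius [t < rho] with [1 < t] and both numerical radii at most
    [R1 < t], and put [r = t^-2] and [de = 2 r / (1 + r) = 2 / (t^2 + 1)].  Let
    [K] be the supremum of the norms of [f(A)] over Laurent polynomials [f]
    bounded by 1 on the circles of radii [t] and [1/t].  The core of the proof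
    is [K^2 <= 4 K + de] when [K > 1] ([extremal_bound]).

    Positivity.  Since [w(A) < t], the operator Poisson kernel
    [2 Re (1 - A / sigma)^-1] is positive on [|sigma| = t] with mean [2]; the
    same holds for [A^-1] on the inner circle.  Integrating [f] against both
    kernels gives an operator [S] of norm at most 4, and term by term
    [S = f(A) + h(A)^* + (3 - de) a_0], where [a_0] is the constant coefficient
    of [f = sum a_n z^n] and [h = sum k_n (conj a_(-n)) z^n] with [k_0 = de] and
    [k_n = r^|n|] otherwise.  The [k_n] are the Fourier coefficients of the
    Poisson kernel of radius [r] minus its minimum, a nonnegative function of
    mean [de]; so [h] is bounded by [de] on both circles ([duality]).

    Extremality.  If [|f(A) u|] is nearly [K] for a unit vector [u], composing
    [f] with a small disc automorphism cannot increase the norm beyond [K], and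
    this forces [f(A) u] to be nearly orthogonal to [u].  Taking the inner
    product of [S u] with [f(A) u] therefore kills the term in [a_0].  As
    [f(A)^* f(A) u] is nearly [K^2 u], the term in [h] is nearly
    [<f(A) u, (f h f)(A) u> / K^2], of modulus at most [de].

    Integrals over circles never appear: for trigonometric polynomials they are
    averages over roots of unity, and the Neumann series of the kernels are
    truncated with a geometrically small error ([kernel_bound],
    [neumann_kernel_bound]).  The decay of the powers of [A / t] needed there is
    Berger's inequality [w(B^n) <= w(B)^n] ([numrange_power]).

    Finally, a rational function without poles in the open annulus of radius
    [rho] is approximated by Laurent polynomials, uniformly on the two circles
    and at the matrix ([approximable_rational]), and [t] tends to [rho]. *)

Local Notation "x %:C" := (real_complex _ x) (format "x %:C") : ring_scope.

(** * Sealed complex and Hermitian arithmetic *)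

(** Sealed copies of the real part, modulus, conjugation, inner product and
    norm: left transparent, they make unification unfold complex arithmetic. *)
HB.lock Definition cre {R : realType} (z : R[i]) : R := complex.Re z.
HB.lock Definition cnorm {R : realType} (z : R[i]) : R := Normc.normc z.
HB.lock Definition cconj {R : realType} (z : R[i]) : R[i] := conjc z.
HB.lock Definition ip {R : realType} {d : nat} (u v : 'cV[R[i]]_d) : R[i] :=
  inner u v.
HB.lock Definition vn {R : realType} {d : nat} (u : 'cV[R[i]]_d) : R := vnorm u.
Canonical cre_unlock := Unlockable cre.unlock.
Canonical cnorm_unlock := Unlockable cnorm.unlock.
Canonical cconj_unlock := Unlockable cconj.unlock.
Canonical ip_unlock := Unlockable ip.unlock.
Canonical vn_unlock := Unlockable vn.unlock.

Section Scalars.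
Context {R : realType}.
Implicit Types (z w : R[i]) (x : R).

Lemma cnormE z : cnorm z = Normc.normc z. Proof. by rewrite unlock. Qed.

Lemma cnorm2 z : cnorm z ^+ 2 = complex.Re z ^+ 2 + complex.Im z ^+ 2.
Proof.
by rewrite unlock; case: z => a b /=; rewrite sqr_sqrtr ?addr_ge0 ?sqr_ge0.
Qed.

Lemma cnorm_ge0 z : 0 <= cnorm z.
Proof. by rewrite unlock; case: z => a b; rewrite sqrtr_ge0. Qed.

Lemma cnorm0 : cnorm (0 : R[i]) = 0.
Proof. by rewrite unlock; exact: Normc.normc0. Qed.

Lemma cnorm1 : cnorm (1 : R[i]) = 1.
Proof. by rewrite unlock; exact: Normc.normc1. Qed.

Lemma cnorm_eq0 z : (cnorm z == 0) = (z == 0).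
Proof.
by rewrite unlock; apply/eqP/eqP => [/Normc.eq0_normc//|->]; exact: Normc.normc0.
Qed.

Lemma cnorm_gt0 z : (0 < cnorm z) = (z != 0).
Proof. by rewrite lt_def cnorm_ge0 andbT cnorm_eq0. Qed.

Lemma cnormM z w : cnorm (z * w) = cnorm z * cnorm w.
Proof. by rewrite unlock Normc.normcM. Qed.

Lemma cnormV z : cnorm z^-1 = (cnorm z)^-1.
Proof. by rewrite unlock Normc.normcV. Qed.

Lemma cnormN z : cnorm (- z) = cnorm z.
Proof. by rewrite unlock normcN. Qed.

Lemma cnormX z n : cnorm (z ^+ n) = cnorm z ^+ n.
Proof.
by elim: n => [|n IHn]; rewrite ?expr0 ?cnorm1// !exprS cnormM IHn.
Qed.

Lemma cnormJ z : cnorm (cconj z) = cnorm z.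
Proof. by rewrite !unlock; case: z => a b /=; rewrite sqrrN. Qed.

Lemma cnorm_real x : cnorm (x%:C) = `|x|.
Proof. by rewrite unlock /= expr0n/= addr0 sqrtr_sqr. Qed.

Lemma cnorm_ge0_real x : 0 <= x -> cnorm (x%:C) = x.
Proof. by move=> x0; rewrite cnorm_real ger0_norm. Qed.

Lemma cnormMn z n : cnorm (z *+ n) = cnorm z *+ n.
Proof. by rewrite unlock normcMn. Qed.

Lemma cnormD z w : cnorm (z + w) <= cnorm z + cnorm w.
Proof. by rewrite unlock le_normcD. Qed.

Lemma cnormB z w : cnorm (z - w) <= cnorm z + cnorm w.
Proof. by rewrite -(cnormN w) cnormD. Qed.

Lemma cnorm_sum (I : Type) (s : seq I) (P : pred I) (F : I -> R[i]) :
  cnorm (\sum_(i <- s | P i) F i) <= \sum_(i <- s | P i) cnorm (F i).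
Proof.
elim/big_rec2 : _ => [|i y1 y2 _ h]; first by rewrite cnorm0.
by apply: le_trans (cnormD _ _) _; rewrite lerD2l.
Qed.

Lemma creD z w : cre (z + w) = cre z + cre w.
Proof. by rewrite unlock; case: z w => [a b] [c d]. Qed.

Lemma creN z : cre (- z) = - cre z.
Proof. by rewrite unlock; case: z. Qed.

Lemma creB z w : cre (z - w) = cre z - cre w.
Proof. by rewrite creD creN. Qed.

Lemma cre0 : cre (0 : R[i]) = 0.
Proof. by rewrite unlock. Qed.

Lemma creMn z n : cre (z *+ n) = cre z *+ n.
Proof. by elim: n => [|n IHn]; rewrite ?mulr0n ?cre0// !mulrSr creD IHn. Qed.

Lemma cre_real x : cre (x%:C) = x.
Proof. by rewrite unlock. Qed.

Lemma cre_sum (I : Type) (s : seq I) (P : pred I) (F : I -> R[i]) :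
  cre (\sum_(i <- s | P i) F i) = \sum_(i <- s | P i) cre (F i).
Proof. by elim/big_rec2 : _ => [|i y1 y2 _ <-]; rewrite ?cre0 ?creD. Qed.

Lemma cre1 : cre (1 : R[i]) = 1.
Proof. by rewrite unlock. Qed.

Lemma creMl x z : cre (x%:C * z) = x * cre z.
Proof. by rewrite unlock; case: z => a b /=; rewrite mul0r subr0. Qed.

Lemma creJ z : cre (cconj z) = cre z.
Proof. by rewrite !unlock; case: z. Qed.

Lemma cre_le_norm z : `|cre z| <= cnorm z.
Proof.
rewrite !unlock; case: z => a b /=.
by rewrite -sqrtr_sqr ler_wsqrtr// lerDl sqr_ge0.
Qed.

Lemma cre_le z : cre z <= cnorm z.
Proof. exact: le_trans (ler_norm _) (cre_le_norm z). Qed.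

Lemma mulcJ z : z * cconj z = (cnorm z ^+ 2)%:C.
Proof.
rewrite cnorm2 unlock; case: z => a b /=; apply/eqP; rewrite eq_complex /=.
by apply/andP; split; apply/eqP; ring.
Qed.

Lemma cconjM z w : cconj (z * w) = cconj z * cconj w.
Proof. by rewrite unlock; exact: rmorphM. Qed.

Lemma cconjD z w : cconj (z + w) = cconj z + cconj w.
Proof. by rewrite unlock; exact: rmorphD. Qed.

Lemma cconjN z : cconj (- z) = - cconj z.
Proof. by rewrite unlock; exact: rmorphN. Qed.

Lemma cconjX z n : cconj (z ^+ n) = cconj z ^+ n.
Proof. by rewrite unlock; exact: rmorphXn. Qed.

Lemma cconjK z : cconj (cconj z) = z.
Proof. by rewrite unlock conjcK. Qed.

Lemma cconj0 : cconj (0 : R[i]) = 0.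
Proof. by rewrite unlock conjc0. Qed.

Lemma cconj1 : cconj (1 : R[i]) = 1.
Proof. by rewrite unlock conjc1. Qed.

Lemma cconj_real x : cconj x%:C = x%:C.
Proof. by rewrite unlock conjc_real. Qed.

Lemma cconj_sum (I : Type) (s : seq I) (P : pred I) (F : I -> R[i]) :
  cconj (\sum_(i <- s | P i) F i) = \sum_(i <- s | P i) cconj (F i).
Proof. by rewrite unlock; exact: rmorph_sum. Qed.

Lemma phase z : exists2 lam, cnorm lam = 1 & lam * z = (cnorm z)%:C.
Proof.
have [->|z0] := eqVneq z 0.
  by exists 1; rewrite ?mulr0 ?cnorm0 //; exact: cnorm1.
have nz : cnorm z != 0 by rewrite cnorm_eq0.
exists ((cnorm z)^-1%:C * cconj z).
  by rewrite cnormM cnormJ cnorm_real ger0_norm ?invr_ge0 ?cnorm_ge0// mulVf.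
by rewrite -mulrA [cconj z * _]mulrC mulcJ -rmorphM expr2 mulKf.
Qed.

End Scalars.

Section Inner.
Context {R : realType} {d : nat}.
Implicit Types (u v x y : 'cV[R[i]]_d).

Lemma ipE u v : ip u v = \sum_i u i 0 * cconj (v i 0).
Proof. rewrite ip.unlock /inner dotmxE mxE; apply: eq_bigr => i _.
by rewrite !mxE cconj.unlock. Qed.

Lemma ipDl u v y : ip (u + v) y = ip u y + ip v y.
Proof.
by rewrite !ipE -big_split; apply: eq_bigr => i _; rewrite mxE mulrDl.
Qed.

Lemma ipZl c u y : ip (c *: u) y = c * ip u y.
Proof.
by rewrite !ipE mulr_sumr; apply: eq_bigr => i _; rewrite mxE mulrA.
Qed.

Lemma ipC u v : ip v u = cconj (ip u v).
Proof.
rewrite !ipE cconj_sum; apply: eq_bigr => i _.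
by rewrite cconjM cconjK mulrC.
Qed.

Lemma ipDr y u v : ip y (u + v) = ip y u + ip y v.
Proof. by rewrite ipC ipDl cconjD -(ipC u y) -(ipC v y). Qed.

Lemma ipZr c y u : ip y (c *: u) = cconj c * ip y u.
Proof. by rewrite ipC ipZl cconjM -(ipC u y). Qed.

Lemma ipNl u y : ip (- u) y = - ip u y.
Proof. by rewrite -scaleN1r ipZl mulN1r. Qed.

Lemma ipNr y u : ip y (- u) = - ip y u.
Proof. by rewrite ipC ipNl cconjN -(ipC u y). Qed.

Lemma ipBl u v y : ip (u - v) y = ip u y - ip v y.
Proof. by rewrite ipDl ipNl. Qed.

Lemma ipBr y u v : ip y (u - v) = ip y u - ip y v.
Proof. by rewrite ipDr ipNr. Qed.

Lemma ip0l y : ip 0 y = 0.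
Proof. by rewrite -(scale0r 0) ipZl mul0r. Qed.

Lemma ip0r y : ip y 0 = 0.
Proof. by rewrite ipC ip0l cconj0. Qed.

Lemma ip_suml (I : Type) (s : seq I) (P : pred I) (F : I -> 'cV[R[i]]_d) y :
  ip (\sum_(i <- s | P i) F i) y = \sum_(i <- s | P i) ip (F i) y.
Proof. by elim/big_rec2 : _ => [|i y1 y2 _ <-]; rewrite ?ip0l ?ipDl. Qed.

Lemma ip_sumr (I : Type) (s : seq I) (P : pred I) (F : I -> 'cV[R[i]]_d) y :
  ip y (\sum_(i <- s | P i) F i) = \sum_(i <- s | P i) ip y (F i).
Proof. by elim/big_rec2 : _ => [|i y1 y2 _ <-]; rewrite ?ip0r ?ipDr. Qed.

Lemma cre_ipC u v : cre (ip v u) = cre (ip u v).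
Proof. by rewrite ipC creJ. Qed.

Lemma ipxx u : ip u u = (\sum_i cnorm (u i 0) ^+ 2)%:C.
Proof. by rewrite ipE rmorph_sum; apply: eq_bigr => i _; rewrite mulcJ. Qed.

Lemma vnormE u : vn u = vnorm u. Proof. by rewrite vn.unlock. Qed.

Lemma vnE u : vn u = Num.sqrt (cre (ip u u)).
Proof. by rewrite !unlock. Qed.

Lemma vn2 u : vn u ^+ 2 = cre (ip u u).
Proof.
by rewrite vnE sqr_sqrtr// ipxx cre_real sumr_ge0// => i _; rewrite sqr_ge0.
Qed.

Lemma ip_vn u : ip u u = (vn u ^+ 2)%:C.
Proof. by rewrite vn2 ipxx cre_real. Qed.

Lemma vn_ge0 u : 0 <= vn u.
Proof. by rewrite vnE sqrtr_ge0. Qed.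

Lemma vn0 : vn (0 : 'cV[R[i]]_d) = 0.
Proof. by rewrite vnE ip0l cre0 sqrtr0. Qed.

Lemma vn0_eq0 u : vn u = 0 -> u = 0.
Proof.
move=> h; have := vn2 u; rewrite h expr0n ipxx cre_real => /esym/eqP.
rewrite psumr_eq0 => [/allP z|i _]; last exact: sqr_ge0.
apply/matrixP => i j; rewrite ord1 mxE; apply/eqP.
by have := z i (mem_index_enum i); rewrite /= sqrf_eq0 cnorm_eq0.
Qed.

Lemma vnZ c u : vn (c *: u) = cnorm c * vn u.
Proof.
rewrite vnE ipZl ipZr mulrA mulcJ creMl sqrtrM ?sqr_ge0// -vnE.
by rewrite sqrtr_sqr ger0_norm ?cnorm_ge0.
Qed.

Lemma vnN u : vn (- u) = vn u.
Proof. by rewrite -scaleN1r vnZ cnormN cnorm1 mul1r. Qed.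

Lemma vnD2 u v :
  vn (u + v) ^+ 2 = vn u ^+ 2 + vn v ^+ 2 + 2 * cre (ip u v).
Proof.
rewrite !vn2 ipDl !ipDr !creD (cre_ipC u v).
by move: (cre _) (cre _) (cre _) => a b c; ring.
Qed.

Lemma vnB2 u v :
  vn (u - v) ^+ 2 = vn u ^+ 2 + vn v ^+ 2 - 2 * cre (ip u v).
Proof. by rewrite vnD2 vnN ipNr creN mulrN. Qed.

Lemma cre_CauchySchwarz u v : cre (ip u v) <= vn u * vn v.
Proof.
have [/vn0_eq0->|v0] := eqVneq (vn v) 0.
  by rewrite ip0r cre0 vn0 mulr0.
have [/vn0_eq0->|u0] := eqVneq (vn u) 0.
  by rewrite ip0l cre0 vn0 mul0r.
have := sqr_ge0 (vn ((vn v)%:C *: u - (vn u)%:C *: v)).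
rewrite vnB2 !vnZ !cnorm_real !ger0_norm ?vn_ge0//.
rewrite ipZl ipZr cconj_real !creMl => h.
have pos : 0 < vn u * vn v by rewrite mulr_gt0// lt_def ?u0 ?v0 vn_ge0.
by rewrite -(ler_pM2l pos); nra.
Qed.

Lemma ip_CauchySchwarz u v : cnorm (ip u v) <= vn u * vn v.
Proof.
have [lam l1 h] := phase (ip u v).
have := cre_CauchySchwarz (lam *: u) v.
by rewrite ipZl h cre_real vnZ l1 mul1r.
Qed.

Lemma vnD u v : vn (u + v) <= vn u + vn v.
Proof.
rewrite -(ler_pXn2r (ltn0Sn 1)) ?nnegrE ?addr_ge0 ?vn_ge0//.
by rewrite vnD2 sqrrD; have := cre_CauchySchwarz u v; lra.
Qed.

Lemma vnB u v : vn (u - v) <= vn u + vn v.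
Proof. by rewrite -(vnN v) vnD. Qed.

Lemma vn_sum (I : Type) (s : seq I) (P : pred I) (F : I -> 'cV[R[i]]_d) :
  vn (\sum_(i <- s | P i) F i) <= \sum_(i <- s | P i) vn (F i).
Proof.
elim/big_rec2 : _ => [|i y1 y2 _ h]; first by rewrite vn0.
by apply: le_trans (vnD _ _) _; rewrite lerD2l.
Qed.

Lemma vn_le_test u (c : R) : 0 <= c ->
  (forall y, vn y = 1 -> cnorm (ip u y) <= c) -> vn u <= c.
Proof.
move=> c0 h; have [->//|u0] := eqVneq (vn u) 0.
have := h ((vn u)^-1%:C *: u); rewrite vnZ cnorm_real.
rewrite ger0_norm ?invr_ge0 ?vn_ge0// mulVf// => /(_ erefl).
rewrite ipZr cconj_real ip_vn -rmorphM cnorm_real expr2 mulKf//.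
by rewrite ger0_norm ?vn_ge0.
Qed.

End Inner.

(** * Averages over roots of unity and positive kernels *)

Section RootsOfUnity.
Context {R : realType}.

Lemma prim_root_exists (n : nat) : (0 < n)%N ->
  exists z : R[i], n.-primitive_root z.
Proof.
move=> n_gt0; pose p : {poly R[i]} := 'X^n - 1.
have [r Dp] := closed_field_poly_normal p.
move: Dp; rewrite (monicP _) ?monicXnsubC // scale1r => Dp.
have rn1 : all n.-unity_root r.
  by apply/allP=> z; rewrite -root_prod_XsubC -Dp.
have sz_r : (n <= size r)%N.
  by rewrite -ltnS -(size_prod_XsubC r id) -Dp size_XnsubC.
have ur : uniq r.
  rewrite -separable_prod_XsubC -Dp separable_Xn_sub_1 //.
  by rewrite pnatr_eq0 -lt0n.
by have /hasP[z _ ?] := has_prim_root n_gt0 rn1 ur sz_r; exists z.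
Qed.

Lemma cnorm_root1 (z : R[i]) (n : nat) :
  (0 < n)%N -> cnorm (z ^+ n) = 1 -> cnorm z = 1.
Proof.
by move=> n0; rewrite cnormX => /eqP; rewrite pexpr_eq1 ?cnorm_ge0// => /eqP.
Qed.

Lemma cconj_unit (z : R[i]) : cnorm z = 1 -> cconj z = z^-1.
Proof.
move=> z1; have z0 : z != 0 by rewrite -cnorm_gt0 z1.
by apply: (mulfI z0); rewrite mulcJ z1 expr1n divff.
Qed.

Lemma prim_root_orthogonality (n a b : nat) (z : R[i]) :
    n.-primitive_root z -> (a < n)%N -> (b < n)%N ->
  \sum_(j < n) (z ^+ j) ^+ a * cconj (z ^+ j) ^+ b = (a == b)%:R *+ n.
Proof.
move=> zP an bn.
have zn : z ^+ n = 1 := prim_expr_order zP.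
have n_gt0 : (0 < n)%N by apply: leq_ltn_trans an.
have z1 : cnorm z = 1 by apply: (@cnorm_root1 _ n) => //; rewrite zn cnorm1.
have z0 : z != 0 by rewrite -cnorm_gt0 z1.
pose t := z ^+ a / z ^+ b.
have E (j : 'I_n) : (z ^+ j) ^+ a * cconj (z ^+ j) ^+ b = t ^+ j.
  rewrite cconjX cconj_unit// -!exprM [(j * a)%N]mulnC [(j * b)%N]mulnC.
  by rewrite !exprM -exprMn exprVn.
rewrite (eq_bigr _ (fun j _ => E j)).
have [ab|ab] := eqVneq a b.
  have -> : t = 1 by rewrite /t ab divff ?expf_neq0.
  by under eq_bigr => j _ do rewrite expr1n; rewrite sumr_const card_ord.
have t1 : t - 1 != 0.
  rewrite subr_eq0 /t; apply: contra ab => /eqP h.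
  have : z ^+ a == z ^+ b by rewrite -[X in X == _](divfK (expf_neq0 b z0)) h mul1r.
  by rewrite (eq_prim_root_expr zP) !modn_small.
apply: (mulfI t1); rewrite -subrX1 mul0rn mulr0.
rewrite /t expr_div_n -!exprM ![(_ * n)%N]mulnC !exprM zn !expr1n divff ?oner_neq0//.
by rewrite subrr.
Qed.

End RootsOfUnity.

Section Kernel.
Context {R : realType} {d : nat}.
Implicit Types (M : 'M[R[i]]_d) (x y : 'cV[R[i]]_d).

(** A positive Hermitian form satisfies [2 |<P x, y>| <= <P x, x> + <P y, y>];
    here [P = M + M^*], evaluated at [lam x - y] for the phase [lam] making the
    cross term real. *)
Lemma accretive_form_le M x y : (forall z, 0 <= cre (ip (M *m z) z)) ->
  cnorm (ip (M *m x) y + ip x (M *m y)) <=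
  cre (ip (M *m x) x) + cre (ip (M *m y) y).
Proof.
move=> Mge0; have [lam l1 h] := phase (ip (M *m x) y + ip x (M *m y)).
have := Mge0 (lam *: x - y).
rewrite mulmxBr -scalemxAr !ipBl !ipBr !ipZl !ipZr !mulrA mulcJ l1 expr1n mul1r.
rewrite (ipC x (M *m y)) -cconjM.
rewrite !creB creJ.
have := congr1 cre h; rewrite cre_real mulrDr creD => <-.
by lra.
Qed.

(** Integrating [f = sum_i al_i w^(i - m)], bounded by 1, against the positive
    operator kernel [sum_k w^-k C_k + w^k C_k^*] extracts the products of
    Fourier coefficients on the left, while the total mass of the kernel is
    [C_0 + C_0^*].  The mean over a fine enough grid of roots of unity is exact
    for these trigonometric polynomials. *)
Lemma kernel_bound (C : nat -> 'M[R[i]]_d) (al : nat -> R[i]) (n s m : nat) x y :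
    (forall w, cnorm w = 1 -> forall z,
       0 <= cre (\sum_(k < n) w ^+ k * ip (C k *m z) z)) ->
    (forall w, cnorm w = 1 -> cnorm (\sum_(i < s) al i * w ^+ i) <= 1) ->
    (s <= n)%N -> (m < n)%N ->
  cnorm (\sum_(i < s) al i * ((m <= i)%:R * ip (C (i - m)%N *m x) y
                             + (i <= m)%:R * ip x (C (m - i)%N *m y)))
  <= cre (ip (C 0%N *m x) x) + cre (ip (C 0%N *m y) y).
Proof.
move=> Cpos al1 sn mn.
(* every frequency that occurs lies strictly between [-N] and [N] *)
pose N := (n + n + n)%N.
have n_gt0 : (0 < n)%N by apply: leq_ltn_trans mn.
have N_gt0 : (0 < N)%N by rewrite !addn_gt0 n_gt0.
have [z zP] := @prim_root_exists R N N_gt0.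
have z1 : cnorm z = 1.
  by apply: (@cnorm_root1 _ _ N) => //; rewrite (prim_expr_order zP) cnorm1.
have zj1 j : cnorm (z ^+ j) = 1 by rewrite cnormX z1 expr1n.
pose M w := \sum_(k < n) cconj w ^+ k *: C k.
have ME w u v : ip (M w *m u) v = \sum_(k < n) cconj w ^+ k * ip (C k *m u) v.
  by rewrite mulmx_suml ip_suml; apply: eq_bigr => k _; rewrite -scalemxAl ipZl.
have ME' w u v : ip u (M w *m v) = \sum_(k < n) w ^+ k * ip u (C k *m v).
  rewrite mulmx_suml ip_sumr; apply: eq_bigr => k _.
  by rewrite -scalemxAl ipZr cconjX cconjK.
pose Q j := ip (M (z ^+ j) *m x) y + ip x (M (z ^+ j) *m y).
have Qle (j : 'I_N) :
    cnorm (Q j) <= cre (ip (M (z ^+ j) *m x) x) + cre (ip (M (z ^+ j) *m y) y).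
  apply: accretive_form_le => v; rewrite ME.
  by apply: Cpos; rewrite cnormJ.
have orth a b : (a < N)%N -> (b < N)%N ->
    \sum_(j < N) (z ^+ j) ^+ a * cconj (z ^+ j) ^+ b = (a == b)%:R *+ N.
  exact: prim_root_orthogonality.
have ltnN a : (a < n)%N -> (a < N)%N by move=> h; rewrite /N; lia.
have mean0 u :
    \sum_(j < N) cre (ip (M (z ^+ j) *m u) u) = cre (ip (C 0%N *m u) u) *+ N.
  rewrite -cre_sum (eq_bigr _ (fun j _ => ME _ _ _)) exchange_big /=.
  have E (k : 'I_n) : \sum_(j < N) cconj (z ^+ j) ^+ k * ip (C k *m u) u =
      (0%N == k)%:R * ip (C k *m u) u *+ N.
    rewrite -mulr_suml -mulrnAl -orth ?ltnN//; congr (_ * _).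
    by apply: eq_bigr => j _; rewrite expr0 mul1r.
  rewrite (eq_bigr _ (fun k _ => E k)) (bigD1 (Ordinal n_gt0)) //= big1.
    by rewrite mul1r addr0 creMn.
  by move=> k k0; rewrite eq_sym (negbTE k0 : (k == 0%N :> nat) = false) mul0r mul0rn.
pose E i := (m <= i)%:R * ip (C (i - m)%N *m x) y
          + (i <= m)%:R * ip x (C (m - i)%N *m y).
have coef (i : 'I_s) :
    \sum_(j < N) (z ^+ j) ^+ i * cconj (z ^+ j) ^+ m * Q j = E i *+ N.
  have lin : (i < n)%N by apply: leq_trans sn.
  have T1 (k : 'I_n) : \sum_(j < N) (z ^+ j) ^+ i * cconj (z ^+ j) ^+ m
      * (cconj (z ^+ j) ^+ k * ip (C k *m x) y) =
      (i == m + k :> nat)%N%:R * ip (C k *m x) y *+ N.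
    rewrite -mulrnAl -orth ?mulr_suml; [|exact: ltnN|by have := ltn_ord k; rewrite /N; lia].
    by apply: eq_bigr => j _; rewrite exprD !mulrA.
  have T2 (k : 'I_n) : \sum_(j < N) (z ^+ j) ^+ i * cconj (z ^+ j) ^+ m
      * ((z ^+ j) ^+ k * ip x (C k *m y)) =
      (i + k == m)%N%:R * ip x (C k *m y) *+ N.
    rewrite -mulrnAl -orth ?mulr_suml; [|by have := ltn_ord k; rewrite /N; lia|exact: ltnN].
    by apply: eq_bigr => j _; rewrite exprD; ring.
  rewrite /Q.
  under eq_bigr => j _ do rewrite ME ME' mulrDr !mulr_sumr.
  rewrite big_split /= exchange_big [X in _ + X]exchange_big /=.
  rewrite (eq_bigr _ (fun k _ => T1 k)) [X in _ + X](eq_bigr _ (fun k _ => T2 k)).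
  rewrite /E mulrnDl !sumrMnl; congr (_ *+ _ + _ *+ _).
    have [mi|im] := leqP m i; last first.
      rewrite mul0r big1// => k _; rewrite (_ : (_ == _) = false) ?mul0r//.
      by apply/eqP; lia.
    have lk : (i - m < n)%N by lia.
    rewrite (bigD1 (Ordinal lk)) //= subnKC// eqxx big1 ?addr0// => k kn.
    rewrite (_ : (_ == _) = false) ?mul0r//; apply: contraNF kn => /eqP h.
    by apply/eqP/val_inj => /=; lia.
  have [mi|im] := leqP i m; last first.
    rewrite mul0r big1// => k _; rewrite (_ : (_ == _) = false) ?mul0r//.
    by apply/eqP; lia.
  have lk : (m - i < n)%N by lia.
  rewrite (bigD1 (Ordinal lk)) //= subnKC// eqxx big1 ?addr0// => k kn.
  rewrite (_ : (_ == _) = false) ?mul0r//; apply: contraNF kn => /eqP h.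
  by apply/eqP/val_inj => /=; lia.
have total : (\sum_(i < s) al i * E i) *+ N =
    \sum_(j < N) (\sum_(i < s) al i * (z ^+ j) ^+ i) * cconj (z ^+ j) ^+ m * Q j.
  rewrite -sumrMnl.
  under [RHS]eq_bigr => j _ do rewrite !mulr_suml.
  rewrite exchange_big; apply: eq_bigr => i _ /=.
  by rewrite -mulrnAr -coef mulr_sumr; apply: eq_bigr => j _; rewrite !mulrA.
have NR : 0 < N%:R :> R by rewrite ltr0n.
rewrite -(ler_pM2l NR) [leRHS]mulr_natl mulrnDl -!mean0 -big_split /=.
rewrite mulr_natl -cnormMn total.
apply: le_trans (cnorm_sum _ _ _ _) _; apply: ler_sum => j _.
apply: le_trans (Qle j).
rewrite !cnormM cnormX cnormJ zj1 expr1n mulr1.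
by rewrite ler_piMl ?cnorm_ge0// al1.
Qed.

End Kernel.

(** * Numerical radius and powers *)

Section NumericalRange.
Context {R : realType} {d : nat}.
Implicit Types (B D T : 'M[R[i]]_d.+1) (x y : 'cV[R[i]]_d.+1).

(** With [z] a primitive [n]-th root of unity and
    [y_j = (sum_(k < n) (z^j D)^k) x], one has [(1 - z^j D) y_j = (1 - D^n) x],
    and the mean of the [y_j] is [x].  Averaging the inequalities
    [0 <= Re <(1 - z^j D) y_j, y_j>] gives the result. *)
Lemma accretive_power D (n : nat) :
    (forall w, cnorm w = 1 -> forall x, 0 <= cre (ip (x - w *: (D *m x)) x)) ->
  (0 < n)%N -> forall x, 0 <= cre (ip (x - D ^+ n *m x) x).
Proof.
move=> Dpos n_gt0 x; have [z zP] := @prim_root_exists R n n_gt0.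
have zn := prim_expr_order zP.
have z1 : cnorm z = 1 by apply: (@cnorm_root1 _ _ n) => //; rewrite zn cnorm1.
pose y j := (\sum_(k < n) (z ^+ j *: D) ^+ k) *m x.
have yE (j : 'I_n) : y j - z ^+ j *: (D *m y j) = x - D ^+ n *m x.
  rewrite /y scalemxAl -[X in X - _]mul1mx -mulmxBl mulmxA mulmxE.
  rewrite -[_ - _]opprB mulNr -subrX1 opprB exprZn -exprM mulnC exprM zn.
  by rewrite expr1n scale1r mulmxBl mul1mx.
have sumy : \sum_(j < n) y j = n%:R *: x.
  rewrite -mulmx_suml exchange_big /=.
  have E (k : 'I_n) : \sum_(j < n) (z ^+ j *: D) ^+ k = ((k == 0%N :> nat)%:R *+ n) *: D ^+ k.
    rewrite -(prim_root_orthogonality _ _ _ _ zP) ?ltn_ord// scaler_suml.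
    by apply: eq_bigr => j _; rewrite exprZn expr0 mulr1.
  rewrite (eq_bigr _ (fun k _ => E k)) (bigD1 (Ordinal n_gt0)) //= big1.
    by rewrite addr0 -scalemxAl mul1mx.
  by move=> k k0; rewrite (negbTE k0 : (k == 0%N :> nat) = false) mul0rn scale0r.
have : 0 <= \sum_(j < n) cre (ip (x - D ^+ n *m x) (y j)).
  apply: sumr_ge0 => j _; rewrite -(yE j); apply: Dpos.
  by rewrite cnormX z1 expr1n.
rewrite -cre_sum -ip_sumr sumy -(rmorph_nat (real_complex R)) ipZr cconj_real.
by rewrite creMl pmulr_rge0 ?ltr0n.
Qed.

(** Berger's power inequality [w(B^n) <= w(B)^n]: rotate [B] by an [n]-th root
    of a phase of [<B^n x, x>] and apply [accretive_power]. *)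
Lemma numrange_power B (q : R) (n : nat) : 0 < q ->
    (forall x, cnorm (ip (B *m x) x) <= q * vn x ^+ 2) ->
  forall x, cnorm (ip (B ^+ n *m x) x) <= q ^+ n * vn x ^+ 2.
Proof.
move=> q0 Bq x; have [->|n0] := posnP n.
  by rewrite !expr0 mul1mx mul1r ip_vn cnorm_real ger0_norm ?sqr_ge0.
have [lam l1 lamE] := phase (ip (B ^+ n *m x) x).
pose mu := n.-root lam; have muE : mu ^+ n = lam by rewrite rootCK.
have mu1 : cnorm mu = 1 by apply: (@cnorm_root1 _ _ n) => //; rewrite muE.
have := accretive_power ((mu * q^-1%:C) *: B) n _ n0 x.
have qn : 0 < q ^+ n by rewrite exprn_gt0.
rewrite exprZn exprMn muE -scalemxAl ipBl ipZl mulrAC lamE -rmorphXn -rmorphM.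
rewrite creB cre_real -vn2 => h.
rewrite -ler_pdivrMl// -exprVn mulrC -subr_ge0; apply: h => w w1 y.
rewrite -scalemxAl ipBl !ipZl creB -vn2 subr_ge0.
apply: le_trans (cre_le _) _; rewrite !cnormM w1 mu1 !mul1r cnorm_ge0_real ?invr_ge0 ?(ltW q0)//.
by rewrite ler_pdivrMl.
Qed.

(** The operator norm is at most twice the numerical radius, by polarization. *)
Lemma vn_le_numrange T (w : R) : 
    (forall x, cnorm (ip (T *m x) x) <= w * vn x ^+ 2) ->
  forall x, vn (T *m x) <= 2 * w * vn x.
Proof.
move=> Tw.
(* the parallelogram identity along the directions [l y], for [l] of modulus 1 *)
have pol l x y : cnorm l = 1 ->
    cnorm (cconj l * ip (T *m x) y + l * ip (T *m y) x) <= w * (vn x ^+ 2 + vn y ^+ 2).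
  move=> l1; rewrite -(ler_pM2l (ltr0n R 2)).
  have -> : 2 * cnorm (cconj l * ip (T *m x) y + l * ip (T *m y) x) =
     cnorm (ip (T *m (x + l *: y)) (x + l *: y) - ip (T *m (x - l *: y)) (x - l *: y)).
    rewrite mulr_natl -cnormMn; congr cnorm.
    rewrite mulmxBr mulmxDr -!scalemxAr !ipBl !ipDl !ipBr !ipDr !ipZl !ipZr.
    by move: (cconj l) => lj; ring.
  apply: le_trans (cnormB _ _) _.
  apply: le_trans (lerD (Tw _) (Tw _)) _.
  by rewrite vnD2 vnB2 !vnZ l1 mul1r; lra.
pose i : R[i] := Complex 0 1.
have i1 : cnorm i = 1 by rewrite unlock /= expr0n expr1n add0r sqrtr1.
have ii : i * i = -1 by apply/eqP; rewrite eq_complex /= !mul0r !mul1r addr0 sub0r oppr0 !eqxx.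
have iJ : cconj i = - i by rewrite unlock; apply/eqP; rewrite eq_complex /= oppr0 !eqxx.
have bound x y : cnorm (ip (T *m x) y) <= w * (vn x ^+ 2 + vn y ^+ 2).
  have h1 := pol 1 x y cnorm1; have hi := pol i x y i1.
  have : cnorm (i * (cconj i * ip (T *m x) y + i * ip (T *m y) x)) <= w * (vn x ^+ 2 + vn y ^+ 2).
    by rewrite cnormM i1 mul1r.
  rewrite iJ mulrDr !mulrA mulrN ii opprK mul1r mulN1r => hm.
  move: h1; rewrite cconj1 !mul1r => hp.
  rewrite -(ler_pM2l (ltr0n R 2)) mulr_natl -cnormMn.
  have -> : ip (T *m x) y *+ 2 = (ip (T *m x) y + ip (T *m y) x) + (ip (T *m x) y - ip (T *m y) x) by ring.
  by apply: le_trans (cnormD _ _) _; lra.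
move=> x; have [x0|x0] := eqVneq (vn x) 0.
  by rewrite (vn0_eq0 _ x0) mulmx0 vn0 mulr0.
have xp : 0 < vn x by rewrite lt_def x0 vn_ge0.
have w0 : 0 <= w.
  have := le_trans (cnorm_ge0 _) (Tw x).
  by rewrite pmulr_lge0// exprn_gt0.
pose x' := (vn x)^-1%:C *: x.
have x'1 : vn x' = 1 by rewrite vnZ cnorm_ge0_real ?invr_ge0 ?(ltW xp)// mulVf.
have : vn (T *m x') <= 2 * w.
  apply: vn_le_test => [|y y1]; first by rewrite mulr_ge0.
  by apply: le_trans (bound _ _) _; rewrite x'1 y1 expr1n; lra.
by rewrite -scalemxAr vnZ cnorm_ge0_real ?invr_ge0 ?(ltW xp)// mulrC ler_pdivrMr.
Qed.

Lemma vn_power_le B (q : R) : 0 < q ->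
    (forall x, cnorm (ip (B *m x) x) <= q * vn x ^+ 2) ->
  forall n x, vn (B ^+ n *m x) <= 2 * q ^+ n * vn x.
Proof.
move=> q0 Bq n; apply: vn_le_numrange => x; exact: numrange_power.
Qed.

End NumericalRange.

(** * Truncated Neumann kernels *)

Section Geometric.
Context {R : realType}.
Implicit Types (a b c e q : R).

Lemma geometric_small q e : 0 < q < 1 -> 0 < e ->
  exists N, forall n, (N <= n)%N -> q ^+ n <= e.
Proof.
move=> /andP[q0 q1] e0.
pose h := q^-1 - 1; have h0 : 0 < h by rewrite subr_gt0 invf_gt1.
have bern n : 1 + n%:R * h <= q^-1 ^+ n.
  elim: n => [|n IHn]; first by rewrite mul0r addr0.
  have n0 : 0 <= n%:R :> R by [].
  rewrite exprSr; apply: le_trans (_ : (1 + n%:R * h) * q^-1 <= _).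
    by rewrite (_ : q^-1 = 1 + h) -?natr1; [nra|rewrite /h; ring].
  by rewrite ler_pM2r ?invr_gt0.
exists (Num.bound (e^-1 / h)) => n Nn.
have := archi_boundP (ltW (divr_gt0 (_ : 0 < e^-1) h0)).
rewrite invr_gt0 => /(_ e0); rewrite ltr_pdivrMr// => hN.
rewrite -[e]invrK -[q]invrK exprVn lef_pV2 ?posrE ?exprn_gt0 ?invr_gt0//.
apply: le_trans (bern n); apply: le_trans (ltW hN) _.
have : (Num.bound (e^-1 / h))%:R * h <= n%:R * h by rewrite ler_pM2r// ler_nat.
by lra.
Qed.

Lemma le_geometric q a b c (N : nat) : 0 < q < 1 ->
  (forall n, (N <= n)%N -> a <= b + c * q ^+ n) -> a <= b.
Proof.
move=> q01 h; have q0 : 0 < q by case/andP: q01.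
rewrite leNgt; apply/negP => ba.
have [c0|c0] := leP c 0.
  have := h N (leqnn N); have : c * q ^+ N <= 0 by rewrite mulr_le0_ge0 ?exprn_ge0 ?(ltW q0).
  by lra.
have e0 : 0 < (a - b) / (2 * c) by rewrite divr_gt0 ?subr_gt0 ?mulr_gt0.
have [M hM] := geometric_small q _ q01 e0.
have := h (maxn N M) (leq_maxl _ _).
have := hM (maxn N M) (leq_maxr _ _).
rewrite ler_pdivlMr ?mulr_gt0// => h1 h2; lra.
Qed.

Lemma geometric_sum_le q (n : nat) : 0 < q < 1 -> \sum_(k < n) q ^+ k <= (1 - q)^-1.
Proof.
move=> /andP[q0 q1]; have h : 0 < 1 - q by rewrite subr_gt0.
rewrite -[leRHS]mulr1 ler_pdivlMl//.
have -> : (1 - q) * \sum_(k < n) q ^+ k = 1 - q ^+ n.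
  by rewrite -[1 - q]opprB mulNr -subrX1 opprB.
by rewrite gerBl exprn_ge0// ltW.
Qed.

Lemma two_sided_geometric (q : R) (m s : nat) : 0 < q < 1 ->
  \sum_(i < s) q ^+ ((i - m) + (m - i)) <= 2 / (1 - q).
Proof.
move=> /andP[q0 q1]; have h : 0 < 1 - q by rewrite subr_gt0.
rewrite ler_pdivlMr//.
have : (\sum_(i < s) q ^+ ((i - m) + (m - i))) * (1 - q) <=
  if (s <= m)%N then q ^+ (m.+1 - s) else 2 - q ^+ (s - m).
  elim: s => [|s IHs].
    by rewrite big_ord0 mul0r subn0 exprn_ge0// ltW.
  rewrite big_ord_recr /= mulrDl.
  apply: le_trans (lerD IHs (lexx _)) _.
  have [sm|ms|sm] := ltngtP s m.
  - have -> : (s - m = 0)%N by apply/eqP; exact: ltnW.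
    by rewrite subSn ?(ltnW sm)// exprS subSS add0n; lra.
  - have -> : (m - s = 0)%N by apply/eqP; exact: ltnW.
    by rewrite subSn ?(ltnW ms)// exprS addn0; lra.
  rewrite sm subnn subSn// subnn expr0 expr1; lra.
move=> hs; apply: le_trans hs _; case: ifP => _.
  by apply: (@le_trans _ _ 1); [rewrite exprn_ile1 ?(ltW q0) ?(ltW q1)|lra].
by rewrite gerBl exprn_ge0// ltW.
Qed.

End Geometric.

Section NeumannKernel.
Context {R : realType} {d : nat}.
Implicit Types (B : 'M[R[i]]_d.+1) (x y : 'cV[R[i]]_d.+1).

(** Truncating [Re (1 - B)^-1 >= 0]: with [Y = (sum_(k < n) B^k) x], the
    inequality [0 <= Re <(1 - B) Y, Y>] reads [Re <B^n x, Y> <= Re <x, Y>], and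
    its left side is geometrically small. *)
Lemma neumann_sum_accretive B (q : R) (n : nat) x : 0 < q < 1 ->
    (forall z, cnorm (ip (B *m z) z) <= q * vn z ^+ 2) ->
  - (4 * q ^+ n / (1 - q)) * vn x ^+ 2 <=
    cre (\sum_(k < n) ip (B ^+ k *m x) x).
Proof.
move=> q01 Bq; have /andP[q0 q1] := q01.
have h : 0 < 1 - q by rewrite subr_gt0.
pose Y := (\sum_(k < n) B ^+ k) *m x.
have YE : Y - B *m Y = x - B ^+ n *m x.
  rewrite /Y -[X in X - _]mul1mx -mulmxBl mulmxA mulmxE -[_ - _]opprB mulNr.
  by rewrite -subrX1 opprB mulmxBl mul1mx.
have -> : \sum_(k < n) ip (B ^+ k *m x) x = ip Y x.
  by rewrite /Y mulmx_suml ip_suml.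
have pw := vn_power_le B q q0 Bq.
have Yle : vn Y <= 2 / (1 - q) * vn x.
  rewrite /Y mulmx_suml; apply: le_trans (vn_sum _ _ _ _) _.
  apply: (@le_trans _ _ (\sum_(k < n) 2 * q ^+ k * vn x)).
    by apply: ler_sum => k _.
  rewrite -mulr_suml -mulr_sumr ler_wpM2r ?vn_ge0// ler_wpM2l//.
  exact: geometric_sum_le.
have pos : 0 <= cre (ip (x - B ^+ n *m x) Y).
  rewrite -YE ipBl creB -vn2 subr_ge0.
  apply: le_trans (cre_le _) _; apply: le_trans (Bq _) _.
  by rewrite ler_piMl ?sqr_ge0// ltW.
move: pos; rewrite ipBl creB subr_ge0 (cre_ipC Y x) => pos; apply: le_trans pos.
rewrite mulNr lerNl; apply: le_trans (ler_norm _) _; rewrite normrN.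
apply: le_trans (cre_le_norm _) _; apply: le_trans (ip_CauchySchwarz _ _) _.
apply: le_trans (ler_pM (vn_ge0 _) (vn_ge0 _) (pw n x) Yle) _.
by rewrite le_eqVlt; apply/orP; left; apply/eqP; field; rewrite gt_eqF.
Qed.

(** The kernel [2 Re (1 - B / w)^-1] is positive of mean 2.  Its truncations
    are made positive by adding a small multiple [eps] of the identity, which
    changes both sides by [O(eps)]. *)
Lemma neumann_kernel_bound B (q : R) (al : nat -> R[i]) (s m : nat) x y :
    0 < q < 1 -> (forall z, cnorm (ip (B *m z) z) <= q * vn z ^+ 2) ->
    (forall w, cnorm w = 1 -> cnorm (\sum_(i < s) al i * w ^+ i) <= 1) ->
    vn x = 1 -> vn y = 1 ->
  cnorm (\sum_(i < s) al i * ((m <= i)%:R * ip (B ^+ (i - m) *m x) y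
                             + (i <= m)%:R * ip x (B ^+ (m - i) *m y))) <= 2.
Proof.
move=> q01 Bq al1 x1 y1; have /andP[q0 q1] := q01.
have h : 0 < 1 - q by rewrite subr_gt0.
pose S := \sum_(i < s) al i * ((m <= i)%:R * ip (B ^+ (i - m) *m x) y
                             + (i <= m)%:R * ip x (B ^+ (m - i) *m y)).
pose L := if (m < s)%N then al m * ip x y else 0.
pose c := 4 / (1 - q).
apply: (@le_geometric _ q _ _ (2 * c + 2 * c * cnorm L) (maxn s m.+1)) => // n.
rewrite geq_max => /andP[sn mn]; have n0 : (0 < n)%N by apply: leq_ltn_trans mn.
pose eps := c * q ^+ n.
have eps0 : 0 <= eps by rewrite mulr_ge0 ?exprn_ge0 ?(ltW q0)// divr_ge0// ltW.
have e2 : (2 * eps)%:C = eps%:C + eps%:C.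
  by rewrite -rmorphD; congr (_ %:C); ring.
pose C k := if k == 0%N then (1 + eps)%:C%:M else B ^+ k.
have C0 z : C 0%N *m z = (1 + eps)%:C *: z by rewrite mul_scalar_mx.
have CE k z : C k *m z = B ^+ k *m z + (k == 0%N)%:R *: (eps%:C *: z).
  rewrite /C; case: eqP => [->|_]; last by rewrite scale0r addr0.
  by rewrite mul_scalar_mx mul1mx scale1r rmorphD scalerDl scale1r.
have := @kernel_bound _ _ C al n s m x y _ al1 sn mn.
rewrite !C0 !ipZl !creMl -!vn2 x1 y1 !expr1n !mulr1.
have -> : \sum_(i < s) al i * ((m <= i)%:R * ip (C (i - m)%N *m x) y
      + (i <= m)%:R * ip x (C (m - i)%N *m y)) = S + (2 * eps)%:C * L.
  have E (i : 'I_s) : al i * ((m <= i)%:R * ip (C (i - m)%N *m x) y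
      + (i <= m)%:R * ip x (C (m - i)%N *m y)) =
      al i * ((m <= i)%:R * ip (B ^+ (i - m) *m x) y
       + (i <= m)%:R * ip x (B ^+ (m - i) *m y)) + (i == m :> nat)%:R * ((2 * eps)%:C * (al i * ip x y)).
    rewrite !CE !ipDl !ipDr !ipZl !ipZr cconj_real !subn_eq0.
    case: (ltngtP i m) => im; rewrite /= ?cconj0 ?cconj1 ?mul0r ?mul1r ?addr0 ?add0r //.
    by rewrite e2; ring.
  rewrite (eq_bigr _ (fun i _ => E i)) big_split; congr (_ + _) => /=.
  rewrite /L; case: ltnP => ms; last first.
    rewrite big1 ?mulr0// => i _; rewrite (_ : (_ == _) = false) ?mul0r//.
    by apply/eqP; have := ltn_ord i; lia.
  rewrite (bigD1 (Ordinal ms)) //= eqxx mul1r big1 ?addr0// => i im.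
  by rewrite (negbTE im : (i == m :> nat) = false) mul0r.
move=> kb.
have {}kb : cnorm (S + (2 * eps)%:C * L) <= 1 + eps + (1 + eps).
  apply: kb => w w1 z.
  have wBq u : cnorm (ip ((w *: B) *m u) u) <= q * vn u ^+ 2.
    by rewrite -scalemxAl ipZl cnormM w1 mul1r.
  have := neumann_sum_accretive (w *: B) q n z q01 wBq.
  have -> : \sum_(k < n) w ^+ k * ip (C k *m z) z =
      \sum_(k < n) ip ((w *: B) ^+ k *m z) z + eps%:C * ip z z.
    under [X in _ = X + _]eq_bigr => k _ do rewrite exprZn -scalemxAl ipZl.
    rewrite (bigD1 (Ordinal n0)) //= [in RHS](bigD1 (Ordinal n0)) //= !expr0 !mul1r.
    rewrite C0 mul1mx ipZl rmorphD mulrDl mul1r -!addrA; congr (_ + _).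
    rewrite addrC; congr (_ + _); apply: eq_bigr => k k0.
    by rewrite /C (negbTE k0 : (k == 0%N :> nat) = false).
  rewrite creD creMl -vn2 (_ : 4 * q ^+ n / (1 - q) = eps); last by rewrite /eps /c; ring.
  lra.
rewrite -[X in cnorm X <= _]/S -[X in cnorm X](addrK ((2 * eps)%:C * L)).
apply: le_trans (cnormB _ _) _.
have e20 : 0 <= 2 * eps by rewrite mulr_ge0.
rewrite cnormM (cnorm_ge0_real _ e20).
have -> : (2 * c + 2 * c * cnorm L) * q ^+ n = 2 * eps + 2 * eps * cnorm L.
  by rewrite /eps; ring.
by lra.
Qed.

End NeumannKernel.

(** * Scalar kernels *)

Section ScalarKernels.
Context {R : realType}.
Implicit Types (al : nat -> R[i]) (r : R) (s m n : nat).

(** The case of [1 x 1] matrices of [kernel_bound]. *)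
Lemma scalar_kernel_bound (c : nat -> R) al n s m :
    (forall w, cnorm w = 1 -> 0 <= cre (\sum_(k < n) (c k)%:C * w ^+ k)) ->
    (forall w, cnorm w = 1 -> cnorm (\sum_(i < s) al i * w ^+ i) <= 1) ->
    (s <= n)%N -> (m < n)%N ->
  cnorm (\sum_(i < s) al i * ((m <= i)%:R * (c (i - m)%N)%:C
                             + (i <= m)%:R * (c (m - i)%N)%:C)) <= 2 * c 0%N.
Proof.
move=> cpos al1 sn mn; pose x : 'cV[R[i]]_1 := const_mx 1.
have xx : ip x x = 1 by rewrite ipE big_ord1 mxE cconj1 mulr1.
have ipl a u v : ip (a%:C%:M *m u : 'cV[R[i]]_1) v = a%:C * ip u v.
  by rewrite mul_scalar_mx ipZl.
have ipr a u v : ip u (a%:C%:M *m v : 'cV[R[i]]_1) = a%:C * ip u v.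
  by rewrite mul_scalar_mx ipZr cconj_real.
have := @kernel_bound _ _ (fun k => (c k)%:C%:M) al n s m x x _ al1 sn mn.
under eq_bigr => i _ do rewrite ipl ipr xx !mulr1.
rewrite ipl xx mulr1 cre_real -mulr2n -[in leRHS]mulr_natl.
apply=> w w1 z.
under eq_bigr => k _ do rewrite ipl mulrCA mulrA.
by rewrite -mulr_suml ip_vn mulrC creMl mulr_ge0 ?sqr_ge0 ?cpos.
Qed.

(** The constant kernel extracts a single coefficient. *)
Lemma coef_bound al s m :
    (forall w, cnorm w = 1 -> cnorm (\sum_(i < s) al i * w ^+ i) <= 1) ->
  (m < s)%N -> cnorm (al m) <= 1.
Proof.
move=> al1 ms.
have := @scalar_kernel_bound (fun k => (k == 0%N)%:R) al s s m _ al1 (leqnn s) ms.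
rewrite (bigD1 (Ordinal ms)) //= leqnn subnn eqxx mul1r -mulr2n.
rewrite big1 ?addr0 => [|i im].
  move=> h; have {h} : cnorm (al m * 1%:C *+ 2) <= 2 * 1.
    rewrite -mulrnAr; apply: h => w w1.
    case: s ms {al1} => // s ms.
    rewrite big_ord_recl big1 ?addr0 => [|i _]; last by rewrite mul0r.
    by rewrite eqxx expr0 mulr1 cre_real.
  by rewrite rmorph1 !mulr1 cnormMn mulr2n; lra.
have im' : (i != m :> nat) := im.
rewrite !subn_eq0; case: ltngtP im' => //= _ _.
  by rewrite rmorph0 !mul0r !mul1r addr0 mulr0.
by rewrite rmorph0 !mul0r !mul1r addr0 mulr0.
Qed.

(** Fourier coefficients of the Poisson kernel of radius [r], with its minimum
    [(1 - r) / (1 + r)] subtracted: the kernel stays nonnegative, and its mean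
    drops to [2 r / (1 + r)]. *)
Definition poisson_weight r (j : nat) : R :=
  if j == 0%N then 2 * r / (1 + r) else r ^+ j.

(** The Poisson kernel is [2 Re (1 - r w)^-1 - 1], and its minimum is
    [(1 - r) / (1 + r)], attained at [w = -1]. *)
Lemma cre_inv_ge r (w : R[i]) : 0 < r < 1 -> cnorm w = 1 ->
  1 / (1 + r) <= cre (1 - r%:C * w)^-1.
Proof.
move=> /andP[r0 r1] w1; set u := 1 - r%:C * w.
have rw : cnorm (r%:C * w) = r by rewrite cnormM w1 mulr1 cnorm_ge0_real// ltW.
have u0 : u != 0.
  apply/eqP => /eqP; rewrite subr_eq0 => /eqP h.
  by move: rw r1; rewrite -h cnorm1 => <-; rewrite ltxx.
have nu : 0 < cnorm u ^+ 2 by rewrite exprn_gt0// cnorm_gt0.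
have -> : u^-1 = (cnorm u ^+ 2)^-1%:C * cconj u.
  apply: (mulfI u0); rewrite divff// mulrCA mulcJ -rmorphM mulVf ?gt_eqF//.
have uc : cre u = 1 - r * cre w by rewrite creB creMl cre1.
have u2 : cnorm u ^+ 2 = 1 - 2 * r * cre w + r ^+ 2.
  rewrite -[LHS]cre_real -mulcJ /u cconjD cconjN cconj1 cconjM cconj_real.
  have -> : (1 - r%:C * w) * (1 - r%:C * cconj w) =
     1%:C - r%:C * w - r%:C * cconj w + (r ^+ 2)%:C * (w * cconj w).
    by rewrite rmorphXn rmorph1 /=; ring.
  rewrite mulcJ w1 expr1n rmorph1 mulr1 creD !creB !creMl creJ cre_real cre1; ring.
rewrite creMl creJ uc [leRHS]mulrC ler_pdivlMr//.
have w1' : - 1 <= cre w.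
  by have := cre_le_norm w; rewrite w1 ler_norml => /andP[].
have r10 : 0 < 1 + r by lra.
rewrite u2 div1r mulrC ler_pdivrMr//.
have : 0 <= r * (1 - r) * (1 + cre w) by rewrite !mulr_ge0//; lra.
by lra.
Qed.

(** Convolution of a function bounded by 1 with a nonnegative kernel of mean
    [2 r / (1 + r)], evaluated at the point 1. *)
Lemma poisson_bound al r s m : 0 < r < 1 ->
    (forall w, cnorm w = 1 -> cnorm (\sum_(i < s) al i * w ^+ i) <= 1) ->
  cnorm (\sum_(i < s) al i * (poisson_weight r ((i - m) + (m - i)))%:C)
    <= 2 * r / (1 + r).
Proof.
move=> r01 al1; have /andP[r0 r1] := r01.
have r10 : 0 < 1 + r by lra.
have h : 0 < 1 - r by rewrite subr_gt0.
pose S := \sum_(i < s) al i * (poisson_weight r ((i - m) + (m - i)))%:C.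
pose L := if (m < s)%N then al m else 0.
pose c := 1 / (1 - r).
apply: (@le_geometric _ r _ _ (2 * c + 2 * c * cnorm L) (maxn s m.+1)) => // n.
rewrite geq_max => /andP[sn mn]; have n0 : (0 < n)%N by apply: leq_ltn_trans mn.
pose eps := c * r ^+ n.
have e2 : (2 * eps)%:C = eps%:C + eps%:C.
  by rewrite -rmorphD; congr (_ %:C); ring.
pose de := 2 * r / (1 + r).
pose C k : R := if k == 0%N then r / (1 + r) + eps else r ^+ k.
have := @scalar_kernel_bound C al n s m _ al1 sn mn.
have -> : \sum_(i < s) al i * ((m <= i)%:R * (C (i - m)%N)%:C
      + (i <= m)%:R * (C (m - i)%N)%:C) = S + (2 * eps)%:C * L.
  have E (i : 'I_s) : al i * ((m <= i)%:R * (C (i - m)%N)%:C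
      + (i <= m)%:R * (C (m - i)%N)%:C) =
      al i * (poisson_weight r ((i - m) + (m - i)))%:C
      + (i == m :> nat)%:R * ((2 * eps)%:C * al i).
    rewrite /C /poisson_weight addn_eq0 !subn_eq0.
    case: (ltngtP i m) => im; rewrite /= ?mul0r ?mul1r ?addr0 ?add0r //.
    - by rewrite (_ : (i - m)%N = 0%N) ?add0n//; lia.
    - by rewrite (_ : (m - i)%N = 0%N) ?addn0//; lia.
    rewrite [_ * al i]mulrC -mulrDr -!rmorphD.
    by congr (_ * (_ %:C)); field; rewrite gt_eqF.
  rewrite (eq_bigr _ (fun i _ => E i)) big_split; congr (_ + _) => /=.
  rewrite /L; case: ltnP => ms; last first.
    rewrite big1 ?mulr0// => i _; rewrite (_ : (_ == _) = false) ?mul0r//.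
    by apply/eqP; have := ltn_ord i; lia.
  rewrite (bigD1 (Ordinal ms)) //= eqxx mul1r big1 ?addr0// => i im.
  by rewrite (negbTE im : (i == m :> nat) = false) mul0r.
move=> kb.
have {}kb : cnorm (S + (2 * eps)%:C * L) <= 2 * (r / (1 + r) + eps).
  apply: kb => w w1.
  pose u := (1 - r%:C * w)^-1.
  have rw : cnorm (r%:C * w) = r by rewrite cnormM w1 mulr1 cnorm_ge0_real// ltW.
  have u0 : 1 - r%:C * w != 0.
    apply/eqP => /eqP; rewrite subr_eq0 => /eqP h'.
    by move: rw (r1); rewrite -h' cnorm1 => <-; rewrite ltxx.
  have -> : \sum_(k < n) (C k)%:C * w ^+ k =
      u - (r%:C * w) ^+ n * u + (eps - 1 / (1 + r))%:C.
    have -> : u - (r%:C * w) ^+ n * u = \sum_(k < n) (r%:C * w) ^+ k.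
      rewrite -[X in X - _]mul1r -mulrBl -[1 - _]opprB subrX1 -mulNr opprB mulrAC.
      by rewrite divff// mul1r.
    rewrite (bigD1 (Ordinal n0)) //= [in RHS](bigD1 (Ordinal n0)) //= !expr0 mulr1.
    rewrite addrAC -[1 in RHS]/(1%:C) -rmorphD; congr (_ + _).
      by rewrite /C eqxx; congr (_ %:C); field; rewrite gt_eqF.
    apply: eq_bigr => k k0.
    by rewrite /C (negbTE k0 : (k == 0%N :> nat) = false) exprMn rmorphXn.
  rewrite creD creB cre_real.
  have h1 := cre_inv_ge r w r01 w1.
  have h2 : cre ((r%:C * w) ^+ n * u) <= eps.
    apply: le_trans (cre_le _) _.
    rewrite cnormM cnormX rw /eps /c mulrC mul1r ler_wpM2r ?exprn_ge0 ?(ltW r0)//.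
    rewrite cnormV lef_pV2 ?posrE ?cnorm_gt0//.
    have := cnormD (1 - r%:C * w) (r%:C * w).
    by rewrite subrK cnorm1 rw; lra.
  by rewrite -/u in h1; lra.
rewrite -[X in cnorm X <= _]/S -[X in cnorm X](addrK ((2 * eps)%:C * L)).
apply: le_trans (cnormB _ _) _.
have eps0 : 0 <= eps by rewrite mulr_ge0 ?exprn_ge0 ?(ltW r0)// divr_ge0// ltW.
have e20 : 0 <= 2 * eps by rewrite mulr_ge0.
rewrite cnormM (cnorm_ge0_real _ e20).
have -> : (2 * c + 2 * c * cnorm L) * r ^+ n = 2 * eps + 2 * eps * cnorm L.
  by rewrite /eps; ring.
by lra.
Qed.

End ScalarKernels.

(** * The extremal argument *)

Section Extremal.
Context {R : realType} {d : nat}.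
Implicit Types (T H : 'M[R[i]]_d.+1) (x y u : 'cV[R[i]]_d.+1).

Definition adjmx T : 'M[R[i]]_d.+1 := \matrix_(i, j) cconj (T j i).

Lemma ip_adjmx T x y : ip (T *m x) y = ip x (adjmx T *m y).
Proof.
rewrite !ipE; under eq_bigr => i _ do rewrite mxE mulr_suml.
rewrite exchange_big; apply: eq_bigr => j _ /=.
rewrite mxE cconj_sum mulr_sumr; apply: eq_bigr => i _.
by rewrite mxE cconjM cconjK; ring.
Qed.

(** A near-maximizer of [|T u|] is a near-eigenvector of [T^* T], because
    [|T^* T u - K^2 u|^2 <= K^2 (K^2 - |T u|^2)]. *)
Lemma near_maximizer T u (K tau : R) : 0 <= tau ->
    (forall x, vn (T *m x) <= K * vn x) -> vn u = 1 -> 0 <= K ->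
    K ^+ 2 - vn (T *m u) ^+ 2 <= tau ^+ 2 ->
  vn (adjmx T *m (T *m u) - (K ^+ 2)%:C *: u) <= K * tau.
Proof.
move=> tau0 TK u1 K0 ktau; set k := vn (T *m u) in ktau *.
have kK : k <= K by rewrite /k; apply: le_trans (TK u) _; rewrite u1 mulr1.
have k0 : 0 <= k by exact: vn_ge0.
pose a := vn (adjmx T *m (T *m u)).
have aK : a <= K * k.
  have a0 : 0 <= a by exact: vn_ge0.
  have : a ^+ 2 <= (K * a) * k.
    rewrite /a vn2 -ip_adjmx; apply: le_trans (cre_le _) _.
    apply: le_trans (ip_CauchySchwarz _ _) _.
    by rewrite ler_wpM2r ?vn_ge0.
  have [->|an] := eqVneq a 0; first by rewrite mulr_ge0.
  have ap : 0 < a by rewrite lt_def an.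
  by rewrite expr2 mulrAC ler_pM2r.
rewrite -(ler_pXn2r (ltn0Sn 1)) ?nnegrE ?vn_ge0 ?mulr_ge0//.
have K2 : 0 <= K ^+ 2 by rewrite sqr_ge0.
rewrite vnB2 vnZ cnorm_ge0_real// u1 mulr1 ipZr cconj_real creMl.
rewrite -cre_ipC -ip_adjmx -vn2 -/k -/a.
have a2 : a ^+ 2 <= (K * k) ^+ 2.
  by rewrite ler_pXn2r ?nnegrE ?vn_ge0 ?mulr_ge0.
have : K ^+ 2 * (K ^+ 2 - k ^+ 2) <= K ^+ 2 * tau ^+ 2 by rewrite ler_wpM2l.
by lra.
Qed.

(** [F c M] stands for [M = f(A)] with [f] bounded by [c].  If a set of matrices
    is stable under products and under composition with disc automorphisms (to
    second order), and every member has a dual as in the last hypothesis, then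
    the supremum [K] of the norms satisfies [K^2 <= 4 K + de] unless [K <= 1]. *)
Theorem extremal_bound (F : R -> 'M[R[i]]_d.+1 -> Prop) (K0 de : R) :
    0 < de <= 3 ->
    F 1 1%:M ->
    (forall c a M, F c M -> F (cnorm a * c) (a *: M)) ->
    (forall c c' M N, F c M -> F c' N -> F (c * c') (M *m N)) ->
    (forall T a, F 1 T -> cnorm a <= 1 -> F (1 + cnorm a ^+ 2)
       (T - a%:M + cconj a *: (T *m T) - (cnorm a ^+ 2)%:C *: T)) ->
    (forall T x, F 1 T -> vn (T *m x) <= K0 * vn x) ->
    (forall T, F 1 T -> exists H a0, [/\ F de H, cnorm a0 <= 1 &
       forall x y, vn x = 1 -> vn y = 1 ->
         cnorm (ip (T *m x) y + ip x (H *m y) + (3 - de)%:C * a0 * ip x y) <= 4]) ->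
  exists2 K, (forall T x, F 1 T -> vn (T *m x) <= K * vn x) &
    K <= 1 \/ K ^+ 2 <= 4 * K + de.
Proof.
move=> /andP[de0 de3] F1 FZ FM Fmob Fbd Fdual.
pose E : set R := [set k | exists T u, [/\ F 1 T, vn u = 1 & k = vn (T *m u)]]%classic.
pose e1 : 'cV[R[i]]_d.+1 := delta_mx 0 0.
have e11 : vn e1 = 1.
  rewrite vnE ipE (bigD1 0) //= big1 => [|i i0].
    by rewrite mxE !eqxx mul1r addr0 cconj1 cre1 sqrtr1.
  by rewrite mxE (negbTE i0) mul0r.
have Esup : has_sup E.
  split; first by exists (vn (1%:M *m e1)); exists 1%:M, e1.
  by exists K0 => k [T [u [FT u1 ->]]]; apply: le_trans (Fbd _ _ FT) _; rewrite u1 mulr1.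
pose K := sup E.
have TK T x : F 1 T -> vn (T *m x) <= K * vn x.
  move=> FT; have [x0|x0] := eqVneq (vn x) 0.
    by rewrite (vn0_eq0 _ x0) mulmx0 vn0 mulr0.
  have xp : 0 < vn x by rewrite lt_def x0 vn_ge0.
  pose x' := (vn x)^-1%:C *: x.
  have cx : cnorm (vn x)^-1%:C = (vn x)^-1.
    by rewrite cnorm_ge0_real// invr_ge0 ltW.
  have : vn (T *m x') <= K.
    apply: ub_le_sup; first by case: Esup.
    by exists T, x'; split=> //; rewrite vnZ cx mulVf.
  by rewrite -scalemxAr vnZ cx mulrC ler_pdivrMr.
have TKc c T x : 0 < c -> F c T -> vn (T *m x) <= c * K * vn x.
  move=> c0 FT; have cc : cnorm (c^-1)%:C = c^-1.
    by rewrite cnorm_ge0_real// invr_ge0 ltW.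
  have FT' : F 1 (c^-1%:C *: T).
    by have := FZ c (c^-1)%:C T FT; rewrite cc mulVf ?gt_eqF.
  have := TK _ x FT'.
  by rewrite -scalemxAl vnZ cc mulrC ler_pdivrMr// mulrAC [K * c]mulrC.
exists K => //; have [|K1] := leP K 1; first by left.
right; rewrite leNgt; apply/negP => contra.
pose ga := K ^+ 2 - (4 * K + de).
have ga0 : 0 < ga by rewrite subr_gt0.
have Kp : 0 < K by apply: lt_trans K1.
have K21 : 0 < K ^+ 2 - 1 by rewrite subr_gt0 exprn_egt1.
(* Suppose [K^2 = 4 K + de + ga] with [0 < ga], and take [tau] so small that the
   two error terms below cannot compensate [ga]. *)
pose t1 := ga / (2 * (1 + de * K)).
pose t2 := ga ^+ 2 * (K ^+ 2 - 1) / (72 * (K * (1 + 3 * K ^+ 2))).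
have den1 : 0 < 2 * (1 + de * K) by nra.
have den2 : 0 < 72 * (K * (1 + 3 * K ^+ 2)) by rewrite !mulr_gt0//; nra.
have t10 : 0 < t1 by rewrite divr_gt0.
have t20 : 0 < t2 by rewrite divr_gt0// mulr_gt0// exprn_gt0.
have [tau [tau0 tau1 taut1 taut2]] :
    exists tau, [/\ 0 < tau, tau <= 1, tau <= t1 & tau <= t2].
  exists (Num.min 1 (Num.min t1 t2)); split; rewrite ?lt_min ?ge_min ?lexx ?ltr01 ?t10 ?t20 ?orbT//.
have eps0 : 0 < tau ^+ 2 / (2 * K) by rewrite divr_gt0 ?exprn_gt0 ?mulr_gt0.
have [_ [T [u [FT u1 ->]]]] := sup_adherent eps0 Esup.
rewrite -/K; set k := vn (T *m u) => kK'.
have kK : k <= K by have := TK T u FT; rewrite u1 mulr1.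
have k0 : 0 <= k by exact: vn_ge0.
have ktau : K ^+ 2 - k ^+ 2 <= tau ^+ 2.
  have : K - k <= tau ^+ 2 / (2 * K) by lra.
  by rewrite ler_pdivlMr ?mulr_gt0// => h; nra.
have Kge0 := ltW Kp; have tau0' := ltW tau0.
have vle := near_maximizer T u K tau tau0' (fun x => TK T x FT) u1 Kge0 ktau.
set v := _ - _ in vle.
have vE : adjmx T *m (T *m u) = (K ^+ 2)%:C *: u + v by rewrite /v addrC subrK.
pose s := ip (T *m u) u.
have sk : cnorm s <= k by apply: le_trans (ip_CauchySchwarz _ _) _; rewrite u1 mulr1.
have s0 : 0 <= cnorm s := cnorm_ge0 s.
(* [s] is small: test the automorphism with parameter [a = (tau / K) s]; to
   first order it changes [Re <T u, T u>] by [c |s|^2 (K^2 - 1)] *)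
have sle : cnorm s ^+ 2 * (K ^+ 2 - 1) <= tau * (K * (1 + 3 * K ^+ 2)).
  pose c := tau / K; have c0 : 0 < c by rewrite divr_gt0.
  have cK : c * K = tau by rewrite divfK ?gt_eqF.
  pose a := c%:C * s.
  have an : cnorm a = c * cnorm s by rewrite cnormM cnorm_ge0_real// ltW.
  have cs : c * cnorm s <= tau by rewrite -cK ler_pM2l// (le_trans sk).
  have a1 : cnorm a <= 1 by rewrite an; exact: le_trans cs tau1.
  have Fg := Fmob T a FT a1.
  have ca0 : 0 < 1 + cnorm a ^+ 2 by have := sqr_ge0 (cnorm a); lra.
  have := TKc _ _ u ca0 Fg.
  set g := _ - _ => gle.
  have {gle} : cre (ip (g *m u) (T *m u)) <= (1 + cnorm a ^+ 2) * K * k.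
    apply: le_trans (cre_le _) _; apply: le_trans (ip_CauchySchwarz _ _) _.
    by rewrite ler_wpM2r//; rewrite u1 mulr1 in gle.
  rewrite /g mulmxBl mulmxDl mulmxBl -!scalemxAl mul_scalar_mx -mulmxA.
  rewrite ipBl ipDl ipBl !ipZl [ip (T *m (T *m u)) _]ip_adjmx vE ipDr ipZr cconj_real.
  rewrite [ip u (T *m u)]ipC -/s !creB creD creB creMl -!vn2 -/k.
  have -> : a * cconj s = (c * cnorm s ^+ 2)%:C by rewrite /a -mulrA mulcJ -rmorphM.
  rewrite mulrDr creD.
  have -> : cconj a * ((K ^+ 2)%:C * s) = (c * K ^+ 2 * cnorm s ^+ 2)%:C.
    rewrite /a cconjM cconj_real mulrACA [cconj s * s]mulrC mulcJ -!rmorphM.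
    by congr (_ %:C); ring.
  rewrite !cre_real an.
  have : - (c * cnorm s * (K * (K * tau))) <= cre (cconj a * ip (T *m u) v).
    rewrite lerNl; apply: le_trans (ler_norm _) _; rewrite normrN.
    apply: le_trans (cre_le_norm _) _; rewrite cnormM cnormJ an.
    have cs0 : 0 <= c * cnorm s by rewrite (mulr_ge0 (ltW c0) s0).
    rewrite (ler_wpM2l cs0)//.
    apply: le_trans (ip_CauchySchwarz _ _) _.
    by rewrite ler_pM ?vn_ge0.
  set S := cnorm s in cs sk s0 *; move=> h1 h2.
  have cS0 : 0 <= c * S by exact: mulr_ge0 (ltW c0) s0.
  have e1' : (c * S) ^+ 2 <= tau ^+ 2 by rewrite ler_pXn2r ?nnegrE.
  have e2 : c * S * (K * (K * tau)) <= tau * (K * (K * tau)).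
    by rewrite ler_wpM2r// !mulr_ge0.
  have k2K : k ^+ 2 <= K ^+ 2 by rewrite ler_pXn2r ?nnegrE.
  have e3 : (c * S) ^+ 2 * (K ^+ 2 + k ^+ 2) <= tau ^+ 2 * (2 * K ^+ 2).
    have kK2 : K ^+ 2 + k ^+ 2 <= 2 * K ^+ 2 by move: k2K; lra.
    have kK20 : 0 <= K ^+ 2 + k ^+ 2 by rewrite addr_ge0 ?sqr_ge0.
    exact: ler_pM (sqr_ge0 _) kK20 e1' kK2.
  have e4 : (1 + (c * S) ^+ 2) * K * k <= (1 + (c * S) ^+ 2) * K ^+ 2.
    rewrite [K ^+ 2]expr2 mulrA; apply: ler_wpM2l => //; apply: mulr_ge0 => //.
    by move: (sqr_ge0 (c * S)); lra.
  have : c * (S ^+ 2 * (K ^+ 2 - 1)) <= tau ^+ 2 * (1 + 3 * K ^+ 2).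
    by lra.
  move=> h; rewrite -(ler_pM2l c0).
  have -> : c * (tau * (K * (1 + 3 * K ^+ 2))) = tau ^+ 2 * (1 + 3 * K ^+ 2).
    by rewrite -cK; ring.
  exact: h.
have [H [a0 [FH a01 dual]]] := Fdual T FT.
have kpos : 0 < k by rewrite lt_def k0 andbT; apply/eqP => k00; rewrite k00 in ktau; nra.
pose y := k^-1%:C *: (T *m u).
have kc : cnorm k^-1%:C = k^-1 by rewrite cnorm_ge0_real// invr_ge0 ltW.
have y1 : vn y = 1 by rewrite vnZ kc -/k mulVf ?gt_eqF.
have := dual u y u1 y1.
rewrite /y -scalemxAr !ipZr cconj_real mulrCA -!mulrDr cnormM kc.
rewrite ler_pdivrMl// ip_vn -/k [ip u (T *m u)]ipC -/s => dual'.
(* replace [u] by [T^* T u / K^2] to bring in [T H T] *)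
have HT : cnorm (ip u (H *m (T *m u))) <= de + de * K * tau.
  have K2p : 0 < K ^+ 2 by rewrite exprn_gt0.
  rewrite -(ler_pM2l K2p).
  have -> : K ^+ 2 * cnorm (ip u (H *m (T *m u))) =
      cnorm (ip (T *m u) (T *m (H *m (T *m u))) - ip v (H *m (T *m u))).
    rewrite -[X in X * _](cnorm_ge0_real _ (ltW K2p)) -cnormM; congr cnorm.
    rewrite -ipZl; have -> : (K ^+ 2)%:C *: u = adjmx T *m (T *m u) - v.
      by rewrite vE addrK.
    by rewrite ipBl ipC -ip_adjmx -ipC.
  have FTHT : F de (T *m (H *m T)).
    by have := FM _ _ _ _ FT (FM _ _ _ _ FH FT); rewrite mul1r mulr1.
  have h1 : vn (T *m (H *m (T *m u))) <= de * K.
    by rewrite !mulmxA -mulmxA; have := TKc _ _ u de0 FTHT; rewrite u1 mulr1 !mulmxA.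
  have h2 : vn (H *m (T *m u)) <= de * K * k by apply: TKc.
  apply: le_trans (cnormB _ _) _.
  have b1 : cnorm (ip (T *m u) (T *m (H *m (T *m u)))) <= K * (de * K).
    apply: le_trans (ip_CauchySchwarz _ _) _.
    by rewrite ler_pM ?vn_ge0.
  have b2 : cnorm (ip v (H *m (T *m u))) <= K * tau * (de * K * K).
    apply: le_trans (ip_CauchySchwarz _ _) _.
    rewrite ler_pM ?vn_ge0//; apply: le_trans h2 _.
    by rewrite ler_pM2l// mulr_gt0.
  by lra.
have k4 : k ^+ 2 <= 4 * k + (de + de * K * tau) + 3 * cnorm s.
  rewrite -[k ^+ 2]ger0_norm ?sqr_ge0// -cnorm_real.
  set G := (3 - de)%:C * a0 * cconj s in dual'.
  have gle : cnorm G <= 3 * cnorm s.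
    rewrite /G !cnormM cnormJ cnorm_ge0_real ?subr_ge0// ler_wpM2r//.
    by have := cnorm_ge0 a0; nra.
  set P := ip u _ in dual' HT.
  have -> : (k ^+ 2)%:C = ((k ^+ 2)%:C + P + G) - (P + G) by ring.
  apply: le_trans (cnormB _ _) _.
  by have := cnormD P G; lra.
have s6 : ga / 6 <= cnorm s.
  have : tau * (2 * (1 + de * K)) <= ga by rewrite -ler_pdivlMr.
  have tau2 : tau ^+ 2 <= tau by rewrite expr2 ler_piMl.
  by move: k4 ktau kK tau2; rewrite /ga; clear; lra.
have : tau * (72 * (K * (1 + 3 * K ^+ 2))) <= ga ^+ 2 * (K ^+ 2 - 1).
  by rewrite -ler_pdivlMr.
have : (ga / 6) ^+ 2 <= cnorm s ^+ 2 by rewrite ler_pXn2r ?nnegrE ?divr_ge0 ?(ltW ga0).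
move=> h1 h2; rewrite -(ler_pM2r K21) in h1.
have h3 := mulr_gt0 (exprn_gt0 2 ga0) K21.
move: h1 h2 h3 sle; clear; lra.
Qed.

End Extremal.

(** * Laurent polynomials bounded on two circles *)

Section Mobius.
Context {R : realType}.
Implicit Types (a v w z : R[i]).

Lemma cnormB2 z w :
  cnorm (z - w) ^+ 2 = cnorm z ^+ 2 + cnorm w ^+ 2 - 2 * cre (z * cconj w).
Proof.
rewrite -[LHS]cre_real -mulcJ cconjD cconjN.
have -> : (z - w) * (cconj z - cconj w) =
    z * cconj z + w * cconj w - z * cconj w - w * cconj z by ring.
rewrite !mulcJ !creB creD !cre_real -[cre (w * _)]creJ cconjM cconjK [cconj w * z]mulrC.
ring.
Qed.

(** The expression is [(v - a) (1 + a^* v)], that is the automorphism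
    [(v - a) / (1 - a^* v)] times [1 - (a^* v)^2]: a polynomial in [v] that
    agrees with the automorphism to first order in [a]. *)
Lemma mobius_bound v a : cnorm v <= 1 -> cnorm a <= 1 ->
  cnorm (v - a + cconj a * (v * v) - (cnorm a ^+ 2)%:C * v) <= 1 + cnorm a ^+ 2.
Proof.
move=> v1 a1; rewrite -mulcJ.
have -> : v - a + cconj a * (v * v) - a * cconj a * v = (v - a) * (1 + cconj a * v).
  by ring.
have le1 : cnorm (v - a) <= cnorm (1 - cconj a * v).
  rewrite -(ler_pXn2r (ltn0Sn 1)) ?nnegrE ?cnorm_ge0// !cnormB2 mul1r cnormM cnormJ.
  rewrite creJ cnorm1 [cconj a * v]mulrC.
  have : 0 <= (1 - cnorm a ^+ 2) * (1 - cnorm v ^+ 2).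
    by rewrite mulr_ge0// subr_ge0 exprn_ile1 ?cnorm_ge0.
  by move: (cre _) => x; lra.
rewrite cnormM; apply: (le_trans (ler_wpM2r (cnorm_ge0 _) le1)).
rewrite -cnormM.
have -> : (1 - cconj a * v) * (1 + cconj a * v) = 1 - (cconj a * v) ^+ 2 by ring.
apply: le_trans (cnormB _ _) _; rewrite cnorm1 lerD2l cnormX cnormM cnormJ.
by rewrite ler_pXn2r ?nnegrE ?mulr_ge0 ?cnorm_ge0// ler_piMr ?cnorm_ge0.
Qed.

End Mobius.

Lemma ip_exprZl {R : realType} {d : nat} (c : R[i]) (B : 'M[R[i]]_d.+1) k x y :
  ip ((c *: B) ^+ k *m x) y = c ^+ k * ip (B ^+ k *m x) y.
Proof. by rewrite exprZn -scalemxAl ipZl. Qed.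

Lemma ip_exprZr {R : realType} {d : nat} (c : R[i]) (B : 'M[R[i]]_d.+1) k x y :
  ip x ((c *: B) ^+ k *m y) = cconj c ^+ k * ip x (B ^+ k *m y).
Proof. by rewrite exprZn -scalemxAl ipZr cconjX. Qed.

(** A Laurent polynomial is represented by a pair [(p, m)] standing for
    [p / 'X^m]. *)
Section Laurent.
Context {R : realType} {d : nat}.
Variables (A : 'M[R[i]]_d.+1) (t : R).
Implicit Types (p : {poly R[i]}) (M : 'M[R[i]]_d.+1).

Definition on_circles (z : R[i]) : Prop := cnorm z = t \/ cnorm z = t^-1.

Definition laurent_bounded (c : R) p (m : nat) : Prop :=
  forall z, on_circles z -> cnorm p.[z] <= c * cnorm z ^+ m.

Definition laurent_mx p (m : nat) : 'M[R[i]]_d.+1 := horner_mx A p * A^-1 ^+ m.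

Lemma horner_mx_commA p : GRing.comm (horner_mx A p) A.
Proof.
by rewrite /GRing.comm -{2 3}[A](horner_mx_X A) -!rmorphM mulrC.
Qed.

Lemma laurent_mxM p1 p2 m1 m2 :
  laurent_mx (p1 * p2) (m1 + m2) = laurent_mx p1 m1 * laurent_mx p2 m2.
Proof.
rewrite /laurent_mx rmorphM exprD -!mulrA; congr (_ * _).
rewrite !mulrA; congr (_ * _); apply: commrX; apply: commrV.
exact: horner_mx_commA.
Qed.

Lemma horner_mx_sum (s : nat) (c : nat -> R[i]) (e : nat -> nat) :
  horner_mx A (\sum_(i < s) c i *: 'X^(e i)) = \sum_(i < s) c i *: A ^+ e i.
Proof.
rewrite rmorph_sum; apply: eq_bigr => i _.
by rewrite /= horner_mxZ rmorphXn /= horner_mx_X.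
Qed.

Lemma laurent_mxE p m :
  laurent_mx p m = \sum_(i < size p) p`_i *: (A ^+ i * A^-1 ^+ m).
Proof.
rewrite /laurent_mx -{1}[p]coefK poly_def (horner_mx_sum _ (fun i => p`_i) id).
by rewrite mulr_suml; apply: eq_bigr => i _; rewrite scalerAl.
Qed.

Hypothesis Aunit : A \is a GRing.unit.

Lemma expr_div_mx i m :
  A ^+ i * A^-1 ^+ m = if (m <= i)%N then A ^+ (i - m) else A^-1 ^+ (m - i).
Proof.
case: leqP => h.
  by rewrite -{1}(subnK h) exprD -mulrA -exprMn_comm ?divrr ?expr1n ?mulr1//; exact: commrV.
rewrite -{1}(subnKC (ltnW h)) exprD mulrA -exprMn_comm ?divrr ?expr1n ?mul1r//; exact: commrV.
Qed.

Lemma laurent_mxMXn p m k : laurent_mx (p * 'X^k) (m + k) = laurent_mx p m.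
Proof.
rewrite laurent_mxM [laurent_mx 'X^k k]/laurent_mx rmorphXn /= horner_mx_X.
by rewrite expr_div_mx leqnn subnn expr0 mulr1.
Qed.

Lemma laurent_mxZ a p m : laurent_mx (a *: p) m = a *: laurent_mx p m.
Proof. by rewrite /laurent_mx horner_mxZ scalerAl. Qed.

Lemma laurent_mxD p1 p2 m : laurent_mx (p1 + p2) m = laurent_mx p1 m + laurent_mx p2 m.
Proof. by rewrite /laurent_mx rmorphD mulrDl. Qed.

Lemma laurent_mxN p m : laurent_mx (- p) m = - laurent_mx p m.
Proof. by rewrite -scaleN1r laurent_mxZ scaleN1r. Qed.

Lemma laurent_mxC a : laurent_mx a%:P 0 = a%:M.
Proof. by rewrite /laurent_mx horner_mx_C expr0 mulr1. Qed.

(** The matrices [f(A)], for [f] a Laurent polynomial bounded by [c] on both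
    boundary circles. *)
Definition calculus_ball (c : R) M : Prop :=
  exists p m, laurent_bounded c p m /\ M = laurent_mx p m.

Lemma calculus_ball1 : calculus_ball 1 1%:M.
Proof.
exists 1%:P, 0%N; split; last by rewrite laurent_mxC.
by move=> z _; rewrite hornerC cnorm1 expr0 mulr1.
Qed.

Lemma calculus_ballZ c a M : calculus_ball c M -> calculus_ball (cnorm a * c) (a *: M).
Proof.
move=> [p [m [pc ->]]]; exists (a *: p), m; split; last by rewrite laurent_mxZ.
move=> z zt; rewrite hornerZ cnormM -mulrA ler_wpM2l ?cnorm_ge0//; exact: pc.
Qed.

Lemma calculus_ballM c c' M N :
  calculus_ball c M -> calculus_ball c' N -> calculus_ball (c * c') (M *m N).
Proof.
move=> [p [m [pc ->]]] [p' [m' [pc' ->]]]; exists (p * p'), (m + m')%N.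
split; last by rewrite laurent_mxM.
move=> z zt; rewrite hornerM cnormM exprD mulrACA.
by apply: ler_pM; rewrite ?cnorm_ge0//; [exact: pc|exact: pc'].
Qed.

Hypothesis t0 : 0 < t.

Lemma on_circles_neq0 z : on_circles z -> z != 0.
Proof. by rewrite -cnorm_gt0 => -[->|->]; rewrite ?invr_gt0. Qed.

Lemma calculus_ball_mobius M a : calculus_ball 1 M -> cnorm a <= 1 ->
  calculus_ball (1 + cnorm a ^+ 2)
    (M - a%:M + cconj a *: (M *m M) - (cnorm a ^+ 2)%:C *: M).
Proof.
move=> [p [m [pc ->]]] a1.
exists (p * 'X^m - a%:P * 'X^(m + m) + cconj a *: (p * p)
        - (cnorm a ^+ 2)%:C *: (p * 'X^m)), (m + m)%N; split; last first.
  rewrite !(laurent_mxD, laurent_mxN, laurent_mxZ) laurent_mxMXn laurent_mxM.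
  by have /= := laurent_mxMXn a%:P 0 (m + m)%N; rewrite add0n laurent_mxC => ->.
move=> z zt; have z0 := on_circles_neq0 z zt.
have zm : z ^+ m != 0 by rewrite expf_neq0.
pose v := p.[z] / z ^+ m.
have v1 : cnorm v <= 1.
  rewrite /v cnormM cnormV ler_pdivrMr ?cnorm_gt0// cnormX; exact: pc.
have pv : p.[z] = v * z ^+ m by rewrite divfK.
rewrite !(hornerD, hornerN, hornerZ, hornerM, hornerC, hornerXn) pv !exprD.
have -> : v * z ^+ m * z ^+ m - a * (z ^+ m * z ^+ m)
    + cconj a * (v * z ^+ m * (v * z ^+ m))
    - (cnorm a ^+ 2)%:C * (v * z ^+ m * z ^+ m) =
  (v - a + cconj a * (v * v) - (cnorm a ^+ 2)%:C * v) * (z ^+ m * z ^+ m) by ring.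
rewrite cnormM cnormM !cnormX ler_wpM2r ?mulr_ge0 ?exprn_ge0 ?cnorm_ge0//.
exact: mobius_bound.
Qed.

End Laurent.

(** * The dual Laurent polynomial *)

Section Duality.
Context {R : realType} {d : nat}.
Variables (A : 'M[R[i]]_d.+1) (t R1 : R).
Hypothesis Aunit : A \is a GRing.unit.
Hypothesis R10 : 0 < R1.
Hypothesis R1t : R1 < t.
Hypothesis wA : forall x, cnorm (ip (A *m x) x) <= R1 * vn x ^+ 2.
Hypothesis wAV : forall x, cnorm (ip (A^-1 *m x) x) <= R1 * vn x ^+ 2.
Implicit Types (p : {poly R[i]}) (M : 'M[R[i]]_d.+1).

Let t0 : 0 < t. Proof. exact: lt_trans R1t. Qed.
Let t_neq0 : t != 0. Proof. by rewrite gt_eqF. Qed.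
Let q01 : 0 < R1 / t < 1.
Proof. by rewrite divr_gt0//= ltr_pdivrMr// mul1r. Qed.
Let tC : t%:C != 0. Proof. by rewrite -cnorm_gt0 cnorm_ge0_real// ltW. Qed.
Let cnt : cnorm t%:C = t. Proof. by rewrite cnorm_ge0_real// ltW. Qed.

Let wB B : (forall x, cnorm (ip (B *m x) x) <= R1 * vn x ^+ 2) ->
  forall x : 'cV_d.+1, cnorm (ip ((t^-1%:C *: B) *m x) x) <= R1 / t * vn x ^+ 2.
Proof.
move=> Bw x; rewrite -scalemxAl ipZl cnormM cnorm_ge0_real ?invr_ge0 ?(ltW t0)//.
by rewrite [R1 / t]mulrC -mulrA ler_wpM2l// invr_ge0 ltW.
Qed.

(* Fourier coefficients of [f] on the outer circle, and of the conjugate of [f]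
   on the inner circle after [w -> conj w]; the shift by [m] is left out *)
Let outer_coef p m (i : nat) := p`_i * (t%:C ^+ i / t%:C ^+ m).
Let inner_coef p m (i : nat) := cconj p`_i * (t%:C ^+ m / t%:C ^+ i).

Lemma outer_bounded p m : laurent_bounded t 1 p m ->
  forall w, cnorm w = 1 -> cnorm (\sum_(i < size p) outer_coef p m i * w ^+ i) <= 1.
Proof.
move=> pb w w1.
have -> : \sum_(i < size p) outer_coef p m i * w ^+ i = p.[t%:C * w] / t%:C ^+ m.
  rewrite horner_coef mulr_suml; apply: eq_bigr => i _.
  by rewrite /outer_coef exprMn; ring.
have tw : cnorm (t%:C * w) = t by rewrite cnormM w1 mulr1.
have := pb (t%:C * w) (or_introl tw).
by rewrite tw mul1r cnormM cnormV cnormX cnt ler_pdivrMr ?exprn_gt0// mul1r.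
Qed.

Lemma inner_bounded p m : laurent_bounded t 1 p m ->
  forall w, cnorm w = 1 -> cnorm (\sum_(i < size p) inner_coef p m i * w ^+ i) <= 1.
Proof.
move=> pb w w1.
have -> : \sum_(i < size p) inner_coef p m i * w ^+ i =
    cconj (p.[cconj w / t%:C] * t%:C ^+ m).
  rewrite horner_coef mulr_suml cconj_sum; apply: eq_bigr => i _.
  rewrite expr_div_n !cconjM !cconjX cconjK cconj_real.
  rewrite -exprVn cconjX -rmorphV ?unitfE ?gt_eqF//= cconj_real rmorphV ?unitfE ?gt_eqF//=.
  by rewrite /inner_coef -exprVn; ring.
have tw : cnorm (cconj w / t%:C) = t^-1 by rewrite cnormM cnormV cnormJ w1 cnt mul1r.
have := pb (cconj w / t%:C) (or_intror tw).
rewrite tw mul1r cnormJ cnormM cnormX cnt exprVn => h.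
by rewrite -ler_pdivlMr ?exprn_gt0// mul1r.
Qed.

(** Cauchy's estimates on the two circles. *)
Lemma coef_decay p m i : laurent_bounded t 1 p m -> (i < size p)%N ->
  cnorm p`_i <= t^-1 ^+ ((i - m) + (m - i)).
Proof.
move=> pb ip.
have h1 := coef_bound _ _ _ (outer_bounded p m pb) ip.
have h2 := coef_bound _ _ _ (inner_bounded p m pb) ip.
rewrite /outer_coef /inner_coef !cnormM cnormJ !cnormV !cnormX cnt in h1 h2.
have [mi|im] := leqP m i.
  have -> : (m - i = 0)%N by apply/eqP; exact: mi.
  rewrite addn0 exprVn -[_^-1]mul1r ler_pdivlMr ?exprn_gt0//.
  by rewrite -[X in t ^+ X / _](subnK mi) exprD mulfK ?expf_neq0 in h1.
have -> : (i - m = 0)%N by apply/eqP; exact: ltnW im.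
rewrite add0n exprVn -[_^-1]mul1r ler_pdivlMr ?exprn_gt0//.
by rewrite -[X in t ^+ X / _](subnK (ltnW im)) exprD mulfK ?expf_neq0 in h2.
Qed.

Lemma power_bound i m x :
  vn ((A ^+ i * A^-1 ^+ m) *m x) <= 2 * R1 ^+ ((i - m) + (m - i)) * vn x.
Proof.
rewrite expr_div_mx//; case: leqP => h.
  have -> : (m - i = 0)%N by apply/eqP.
  by rewrite addn0; exact: vn_power_le.
have -> : (i - m = 0)%N by apply/eqP; exact: ltnW.
by rewrite add0n; exact: vn_power_le.
Qed.

(** The bound is crude; it only ensures that the supremum of the norms is
    finite. *)
Lemma calculus_ball_le M x : calculus_ball A t 1 M ->
  vn (M *m x) <= 4 / (1 - R1 / t) * vn x.
Proof.
move=> [p [m [pb ->]]]; rewrite laurent_mxE mulmx_suml.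
apply: le_trans (vn_sum _ _ _ _) _.
have q1 : 0 < 1 - R1 / t by rewrite subr_gt0; case/andP: q01.
apply: (@le_trans _ _ (\sum_(i < size p) 2 * vn x * (R1 / t) ^+ ((i - m) + (m - i)))).
  apply: ler_sum => i _; rewrite -scalemxAl vnZ.
  apply: le_trans (ler_pM (cnorm_ge0 _) (vn_ge0 _) (coef_decay p m i pb (ltn_ord i)) (power_bound i m x)) _.
  by rewrite expr_div_n exprVn; lra.
rewrite -mulr_sumr.
apply: le_trans (ler_wpM2l _ (two_sided_geometric _ m (size p) q01)) _.
  by rewrite mulr_ge0 ?vn_ge0.
by lra.
Qed.

Let r := t^-1 ^+ 2.
Let de := 2 * r / (1 + r).

(** Numerator over ['X^(size p)] of the function [h] with
    [conj (h z) = sum_n k_n a_n (conj z)^-n], where [sum_n a_n z^n] is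
    [p / 'X^m]. *)
Definition dual_poly p m : {poly R[i]} :=
  \sum_(i < size p) ((poisson_weight r ((i - m) + (m - i)))%:C * cconj p`_i)
     *: 'X^(m + size p - i).

(** The values of [h] on a circle are conjugates of a convolution of [f] on the
    other circle with the Poisson kernel minus its minimum, because
    [z -> 1 / conj z] exchanges the two circles. *)
Lemma dual_bounded p m : 0 < r < 1 -> laurent_bounded t 1 p m ->
  laurent_bounded t de (dual_poly p m) (size p).
Proof.
move=> r01 pb z zt; have z0 := on_circles_neq0 t t0 z zt.
have zc0 : cconj z != 0 by rewrite -cnorm_gt0 cnormJ cnorm_gt0.
pose v := (cconj z)^-1; have v0 : v != 0 by rewrite invr_eq0.
have vn' : cnorm v = (cnorm z)^-1 by rewrite cnormV cnormJ.
pose al i := p`_i * (v ^+ i / v ^+ m).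
have al1 w : cnorm w = 1 -> cnorm (\sum_(i < size p) al i * w ^+ i) <= 1.
  move=> w1.
  have -> : \sum_(i < size p) al i * w ^+ i = p.[v * w] / v ^+ m.
    rewrite horner_coef mulr_suml; apply: eq_bigr => i _.
    by rewrite /al exprMn; ring.
  have vw : cnorm (v * w) = (cnorm z)^-1 by rewrite cnormM w1 mulr1.
  have vwt : on_circles t (v * w).
    by rewrite /on_circles vw; case: zt => ->; [right|left; rewrite invrK].
  have := pb _ vwt.
  rewrite vw mul1r cnormM cnormV cnormX vn' ler_pdivrMr ?mul1r//.
  by rewrite exprn_gt0// invr_gt0 cnorm_gt0.
have := poisson_bound al r (size p) m r01 al1.
rewrite -/de.
have -> : \sum_(i < size p) al i * (poisson_weight r ((i - m) + (m - i)))%:C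
    = cconj (dual_poly p m).[z] / cconj z ^+ size p.
  rewrite /dual_poly horner_sum cconj_sum mulr_suml; apply: eq_bigr => i _.
  rewrite hornerZ hornerXn !cconjM cconjK cconj_real cconjX.
  have -> : (m + size p - i = m + (size p - i))%N by rewrite addnBA// ltnW.
  have cs : cconj z ^+ size p = cconj z ^+ (size p - i) * cconj z ^+ i.
    by rewrite -exprD subnK// ltnW.
  rewrite cs /al /v !exprVn exprD.
  have := expf_neq0 i zc0; have := expf_neq0 (size p - i) zc0.
  have := expf_neq0 m zc0.
  set x := cconj z ^+ m; set y := cconj z ^+ i; set y' := _ ^+ (_ - _).
  by move=> x0 y'0 y0; field; rewrite y0 y'0 x0.
rewrite cnormM cnormV !cnormX !cnormJ ler_pdivrMr// exprn_gt0// cnorm_gt0//.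
Qed.

(** The sum of the outer and inner kernel identities, each bounded by 2.  The
    powers of [A] and [A^-1] that reproduce [f(A)] come without weight; the
    conjugate ones carry [r^|n|].  At frequency 0 the kernels give [4 a_0], of
    which [f(A)] takes [a_0] and [h(A)^*] takes [de a_0]. *)
Lemma duality M : 0 < r < 1 -> calculus_ball A t 1 M ->
  exists H a0, [/\ calculus_ball A t de H, cnorm a0 <= 1 &
    forall x y, vn x = 1 -> vn y = 1 ->
      cnorm (ip (M *m x) y + ip x (H *m y) + (3 - de)%:C * a0 * ip x y) <= 4].
Proof.
move=> r01 [p [m [pb ->]]].
pose a0 := if (m < size p)%N then p`_m else 0.
exists (laurent_mx A (dual_poly p m) (size p)), a0; split.
- by exists (dual_poly p m), (size p); split=> //; exact: dual_bounded.
- rewrite /a0; case: ifP => [mp|_]; last by rewrite cnorm0.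
  by have := coef_decay p m m pb mp; rewrite subnn.
move=> x y x1 y1.
have outerP := neumann_kernel_bound (t^-1%:C *: A) (R1 / t) (outer_coef p m)
  (size p) m x y q01 (wB A wA) (outer_bounded p m pb) x1 y1.
have innerP := neumann_kernel_bound (t^-1%:C *: A^-1) (R1 / t) (inner_coef p m)
  (size p) m y x q01 (wB _ wAV) (inner_bounded p m pb) y1 x1.
rewrite -cnormJ cconj_sum in innerP.
have H : ip (laurent_mx A p m *m x) y + ip x (laurent_mx A (dual_poly p m) (size p) *m y)
    + (3 - de)%:C * a0 * ip x y = 
  \sum_(i < size p) p`_i * (
    ip ((A ^+ i * A^-1 ^+ m) *m x) y
    + (poisson_weight r ((i - m) + (m - i)))%:C * ip x ((A ^+ m * A^-1 ^+ i) *m y)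
    + (i == m :> nat)%:R * (3 - de)%:C * ip x y).
  rewrite laurent_mxE mulmx_suml ip_suml.
  rewrite {1}/laurent_mx /dual_poly (horner_mx_sum _ _
    (fun i => (poisson_weight r ((i - m) + (m - i)))%:C * cconj p`_i)
    (fun i => m + size p - i)%N).
  rewrite mulr_suml mulmx_suml ip_sumr -big_split /=.
  have -> : (3 - de)%:C * a0 * ip x y =
      \sum_(i < size p) p`_i * ((i == m :> nat)%:R * (3 - de)%:C * ip x y).
    rewrite /a0; case: ltnP => mp; last first.
      rewrite mulr0 mul0r big1// => i _; rewrite (_ : (_ == _) = false) ?mul0r ?mulr0//.
      by apply: contraTF mp => /eqP <-; rewrite -ltnNge.
    rewrite (bigD1 (Ordinal mp)) //= eqxx mul1r big1 => [|i im]; first by ring.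
    by rewrite (negbTE im : (i == m :> nat) = false) !mul0r mulr0.
  rewrite -big_split; apply: eq_bigr => i _ /=.
  rewrite -scalemxAl ipZl -scalerAl -scalemxAl ipZr cconjM cconjK cconj_real.
  have -> : A ^+ (m + size p - i) * A^-1 ^+ size p = A ^+ m * A^-1 ^+ i.
    have is' := ltnW (ltn_ord i).
    rewrite -addnBA// exprD.
    rewrite -[in A^-1 ^+ size p](subnK is') exprD -!mulrA; congr (_ * _).
    rewrite mulrA -exprMn_comm ?divrr ?expr1n ?mul1r//; exact: commrV.
  by ring.
rewrite {}H.
have ti0 : t^-1%:C = t%:C^-1 :> R[i] by rewrite rmorphV// unitfE.
have pow k : (t^-1%:C : R[i]) ^+ k = t%:C ^- k by rewrite ti0 exprVn.
have ratio1 a b : (b <= a)%N -> t%:C ^+ a / t%:C ^+ b * t^-1%:C ^+ (a - b) = 1.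
  move=> ba; rewrite pow -[X in t%:C ^+ X / _](subnK ba) exprD mulfK ?expf_neq0//.
  by rewrite divff ?expf_neq0.
have ratio2 a b : (b <= a)%N ->
    t%:C ^+ b / t%:C ^+ a * t^-1%:C ^+ (a - b) = (r ^+ (a - b))%:C.
  move=> ba; rewrite /r -exprM mul2n -addnn exprD rmorphM rmorphXn /= pow.
  congr (_ * _).
  by rewrite -[X in _ / t%:C ^+ X](subnK ba) exprD invfM mulrCA divff ?expf_neq0 ?mulr1.
have -> : \sum_(i < size p) p`_i * (
    ip ((A ^+ i * A^-1 ^+ m) *m x) y
    + (poisson_weight r ((i - m) + (m - i)))%:C * ip x ((A ^+ m * A^-1 ^+ i) *m y)
    + (i == m :> nat)%:R * (3 - de)%:C * ip x y) =
  \sum_(i < size p) outer_coef p m i *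
      ((m <= i)%:R * ip ((t^-1%:C *: A) ^+ (i - m) *m x) y +
       (i <= m)%:R * ip x ((t^-1%:C *: A) ^+ (m - i) *m y)) +
  \sum_(i < size p) cconj (inner_coef p m i *
      ((m <= i)%:R * ip ((t^-1%:C *: A^-1) ^+ (i - m) *m y) x +
       (i <= m)%:R * ip y ((t^-1%:C *: A^-1) ^+ (m - i) *m x))).
  rewrite -big_split; apply: eq_bigr => i _ /=.
  rewrite !(expr_div_mx A Aunit) /outer_coef /inner_coef !ip_exprZl !ip_exprZr.
  rewrite cconj_real /poisson_weight addn_eq0 !subn_eq0.
  have cT k : cconj (t%:C ^+ k) = t%:C ^+ k by rewrite cconjX cconj_real.
  have cTV k : cconj (t%:C ^+ k)^-1 = (t%:C ^+ k)^-1.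
    by rewrite -pow cconjX cconj_real.
  have [mi|im|im] := ltngtP m i.
  - have -> : (m - i = 0)%N by apply/eqP; exact: ltnW.
    rewrite !mul1r !mul0r !addr0 !cconjM cconjK cT cTV -ipC cconjX cconj_real.
    rewrite addn0 -(ratio2 _ _ (ltnW mi)) -[X in p`_i * (X + _)]mul1r -(ratio1 _ _ (ltnW mi)).
    by ring.
  - have -> : (i - m = 0)%N by apply/eqP; exact: ltnW.
    rewrite !mul1r !mul0r !addr0 !add0r !cconjM cconjK cT cTV -ipC cconjX cconj_real.
    rewrite -(ratio2 _ _ (ltnW im)) -[X in p`_i * (X + _)]mul1r -(ratio1 _ _ (ltnW im)).
    by ring.
  rewrite im subnn !expr0 !mul1mx !mul1r divff ?expf_neq0// !mulr1.
  rewrite cconjM cconjK cconjD -ipC.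
  have -> : (3 - de)%:C = 1 + 1 + 1 - de%:C.
    rewrite -[1 : R[i]]/(1%:C) -!rmorphD -rmorphB; congr (_ %:C); ring.
  by rewrite -/de; ring.
apply: le_trans (cnormD _ _) _.
by apply: le_trans (lerD outerP innerP) _; lra.
Qed.

End Duality.

(** * Approximation by Laurent polynomials *)

Section MatrixBounds.
Context {R : realType} {d : nat}.

Lemma mx_bounded (M : 'M[R[i]]_d.+1) :
  exists2 c : R, 0 <= c & forall x, vn (M *m x) <= c * vn x.
Proof.
exists (\sum_j vn (col j M)); first by apply: sumr_ge0 => j _; exact: vn_ge0.
move=> x.
have -> : M *m x = \sum_j x j 0 *: col j M.
  apply/matrixP => i k; rewrite ord1 mxE summxE; apply: eq_bigr => j _.
  by rewrite !mxE mulrC.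
apply: le_trans (vn_sum _ _ _ _) _; rewrite mulr_suml; apply: ler_sum => j _.
rewrite vnZ mulrC ler_wpM2l ?vn_ge0//.
rewrite -(ler_pXn2r (ltn0Sn 1)) ?nnegrE ?vn_ge0 ?cnorm_ge0//.
rewrite vn2 ipxx cre_real (bigD1 j) //= lerDl; apply: sumr_ge0 => k _.
exact: sqr_ge0.
Qed.

Lemma unitmx_inj (M : 'M[R[i]]_d.+1) :
  (forall x : 'cV_d.+1, M *m x = 0 -> x = 0) -> M \is a GRing.unit.
Proof.
move=> Minj; rewrite -[_ \is a _]/(M \in unitmx) -unitmx_tr unitmxE unitfE.
apply/negP => /det0P[v v0 vM]; move: v0.
rewrite -[v]trmxK (Minj v^T) ?trmx0 ?eqxx//.
by rewrite -[M]trmxK -trmx_mul vM trmx0.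
Qed.

End MatrixBounds.

Section Approximation.
Context {R : realType} {d : nat}.
Variables (A : 'M[R[i]]_d.+1) (t : R).
Hypothesis Aunit : A \is a GRing.unit.
Hypothesis t0 : 0 < t.
Implicit Types (phi psi : R[i] -> R[i]) (M N : 'M[R[i]]_d.+1).

Definition is_laurent phi M : Prop :=
  exists p m, (forall z, on_circles t z -> phi z = p.[z] / z ^+ m) /\
    M = laurent_mx A p m.

Lemma is_laurentC a : is_laurent (fun=> a) a%:M.
Proof.
exists a%:P, 0%N; split; last by rewrite laurent_mxC.
by move=> z _; rewrite hornerC expr0 divr1.
Qed.

Lemma is_laurentX : is_laurent id A.
Proof.
exists 'X, 0%N; split; last by rewrite /laurent_mx horner_mx_X expr0 mulr1.
by move=> z _; rewrite hornerX expr0 divr1.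
Qed.

Lemma is_laurentV : is_laurent (fun z => z^-1) A^-1.
Proof.
exists 1%:P, 1%N; split; last by rewrite /laurent_mx rmorph1 expr1 mul1r.
by move=> z _; rewrite hornerC expr1 mul1r.
Qed.

Lemma is_laurentM phi psi M N : is_laurent phi M -> is_laurent psi N ->
  is_laurent (fun z => phi z * psi z) (M * N).
Proof.
move=> [p [m [pE ->]]] [p' [m' [pE' ->]]]; exists (p * p'), (m + m')%N.
split; last by rewrite laurent_mxM.
by move=> z zt; rewrite pE// pE'// hornerM exprD invfM; ring.
Qed.

Lemma is_laurentD phi psi M N : is_laurent phi M -> is_laurent psi N ->
  is_laurent (fun z => phi z + psi z) (M + N).
Proof.
move=> [p [m [pE ->]]] [p' [m' [pE' ->]]].
exists (p * 'X^m' + p' * 'X^m), (m + m')%N; split; last first.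
  by rewrite laurent_mxD laurent_mxMXn// addnC laurent_mxMXn.
move=> z zt; rewrite pE// pE'// hornerD !hornerM !hornerXn exprD.
have z0 := on_circles_neq0 t t0 z zt.
have := expf_neq0 m z0; have := expf_neq0 m' z0.
by set x := z ^+ m; set y := z ^+ m' => y0 x0; field; rewrite x0 y0.
Qed.

Lemma is_laurent_geometric psi N n : is_laurent psi N ->
  is_laurent (fun z => \sum_(k < n) psi z ^+ k) (\sum_(k < n) N ^+ k).
Proof.
move=> psiN; elim: n => [|n [p [m [pE IHn]]]].
  have [p [m [pE pM]]] := is_laurentC 0.
  exists p, m; split; last by rewrite big_ord0 -pM rmorph0.
  by move=> z zt; rewrite big_ord0 -(pE z zt).
have [|p' [m' [pE' pM']]] := is_laurentD (fun z => \sum_(k < n) psi z ^+ k * psi z)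
   (fun=> 1) (\sum_(k < n) N ^+ k * N) 1%:M _ (is_laurentC 1).
  have [p1 [m1 [pE1 pM1]]] := is_laurentM (fun z => \sum_(k < n) psi z ^+ k) psi
    (\sum_(k < n) N ^+ k) N (ex_intro _ p (ex_intro _ m (conj pE IHn))) psiN.
  exists p1, m1; split; last by rewrite -pM1 mulr_suml.
  by move=> z zt; rewrite -pE1// mulr_suml.
exists p', m'; split.
  move=> z zt; rewrite -pE'// big_ord_recl expr0 addrC; congr (_ + _).
  by apply: eq_bigr => k _; rewrite -exprSr.
rewrite -pM' big_ord_recl expr0 addrC; congr (_ + _).
by apply: eq_bigr => k _; rewrite -exprSr.
Qed.

(** [M] is the value at [A] of [phi], as a limit of Laurent polynomials
    uniform on the circles and at [A]; the bound on [phi] makes the notion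
    multiplicative. *)
Definition approximable phi M : Prop :=
  (exists2 c : R, 0 <= c & forall z, on_circles t z -> cnorm (phi z) <= c) /\
  forall e : R, 0 < e -> exists psi N, [/\ is_laurent psi N,
    forall z, on_circles t z -> cnorm (psi z - phi z) <= e &
    forall x, vn ((N - M) *m x) <= e * vn x].

Lemma approximableM phi psi M N : approximable phi M -> approximable psi N ->
  approximable (fun z => phi z * psi z) (M * N).
Proof.
move=> [[a a0 phia] phiM] [[b b0 psib] psiN]; split.
  exists (a * b); first by rewrite mulr_ge0.
  by move=> z zt; rewrite cnormM ler_pM ?cnorm_ge0//; [exact: phia|exact: psib].
have [am am0 Mam] := mx_bounded M; have [bm bm0 Nbm] := mx_bounded N.
move=> e e0; pose D := a + b + am + bm + 1.
have D0 : 0 < D by rewrite /D; lra.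
pose e' := Num.min 1 (e / D).
have e'0 : 0 < e' by rewrite lt_min ltr01 divr_gt0.
have e'1 : e' <= 1 by rewrite ge_min lexx.
have e'D : e' * D <= e by rewrite -ler_pdivlMr// ge_min lexx orbT.
have [f [F [fF fphi FM]]] := phiM e' e'0.
have [g [G [gG gpsi GN]]] := psiN e' e'0.
exists (fun z => f z * g z), (F * G); split; first exact: is_laurentM.
  move=> z zt.
  have -> : f z * g z - phi z * psi z = (f z - phi z) * (g z - psi z)
      + (f z - phi z) * psi z + phi z * (g z - psi z) by ring.
  have h1 := fphi z zt; have h2 := gpsi z zt; have h3 := phia z zt.
  have h4 := psib z zt.
  apply: le_trans (cnormD _ _) _; apply: le_trans (lerD (cnormD _ _) (lexx _)) _.
  rewrite !cnormM.
  have k1 : cnorm (f z - phi z) * cnorm (g z - psi z) <= e' * 1.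
    by rewrite ler_pM ?cnorm_ge0// (le_trans h2).
  have k2 : cnorm (f z - phi z) * cnorm (psi z) <= e' * b by rewrite ler_pM ?cnorm_ge0.
  have k3 : cnorm (phi z) * cnorm (g z - psi z) <= a * e' by rewrite ler_pM ?cnorm_ge0.
  have k4 : 0 <= e' * (am + bm) by rewrite mulr_ge0 ?addr_ge0// ltW.
  by move: e'D; rewrite /D; lra.
move=> x.
have -> : F * G - M * N = (F - M) * G + M * (G - N).
  by rewrite mulrBl mulrBr addrA subrK.
rewrite mulmxDl -!mulmxA; apply: le_trans (vnD _ _) _.
have h1 : vn (G *m x) <= (1 + bm) * vn x.
  have -> : G *m x = (G - N) *m x + N *m x by rewrite -mulmxDl subrK.
  apply: le_trans (vnD _ _) _; rewrite mulrDl lerD//.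
  by apply: le_trans (GN x) _; rewrite ler_wpM2r ?vn_ge0.
have h2 : vn ((F - M) *m (G *m x)) <= e' * ((1 + bm) * vn x).
  by apply: le_trans (FM _) _; rewrite ler_pM2l.
have h3 : vn (M *m ((G - N) *m x)) <= am * (e' * vn x).
  by apply: le_trans (Mam _) _; rewrite ler_wpM2l.
have h4 : e' * (1 + bm + am) * vn x <= e * vn x.
  rewrite ler_wpM2r ?vn_ge0//; apply: le_trans e'D.
  by rewrite ler_pM2l// /D; lra.
by lra.
Qed.

(** [1 / (z - b)] is [g / (1 - u)] for a monomial [u] that is small on the
    circles, and the geometric series of [u] also converges at the matrix. *)
Lemma approximable_geometric (b : R[i]) (u g : R[i] -> R[i]) U G (th c : R) :
    is_laurent u U -> is_laurent g G -> 0 < th < 1 -> 0 <= c ->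
    (forall z, on_circles t z ->
       [/\ z - b != 0, (z - b) * g z = 1 - u z, cnorm (u z) <= th
         & cnorm (z - b)^-1 <= c]) ->
    G * (A - b%:M) = 1 - U ->
    (forall n x, vn (U ^+ n *m x) <= 2 * th ^+ n * vn x) ->
  A - b%:M \is a GRing.unit /\
  approximable (fun z => (z - b)^-1) (A - b%:M)^-1.
Proof.
move=> uU gG th01 c0 zP GU Upow.
have geoU n : (\sum_(k < n) U ^+ k) * (1 - U) = 1 - U ^+ n.
  have com : GRing.comm (\sum_(k < n) U ^+ k) (1 - U).
    apply: commr_sym; apply: commr_sum => k _; apply: commr_sym.
    by apply: commrB; [exact: commr1|apply: commr_sym; exact: commrX].
  by rewrite com -[1 - U]opprB mulNr -subrX1 opprB.
have unit : A - b%:M \is a GRing.unit.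
  apply: unitmx_inj => x Abx.
  have Ux : U *m x = x.
    have : (1 - U) *m x = 0 by rewrite -GU -mulmxE -mulmxA Abx mulmx0.
    by rewrite mulmxBl mul1mx => /eqP; rewrite subr_eq0 => /eqP.
  have Unx n : U ^+ n *m x = x.
    by elim: n => [|n IHn]; rewrite ?expr0 ?mul1mx// exprSr -mulmxE -mulmxA Ux.
  apply: vn0_eq0; apply/eqP; rewrite eq_le vn_ge0 andbT.
  apply: (@le_geometric _ th _ _ (2 * vn x) 0%N) => // n _.
  by have := Upow n x; rewrite Unx; lra.
split=> //; split; first by exists c => // z /zP[].
have [k k0 invk] := mx_bounded (A - b%:M)^-1.
move=> e e0; pose D := c + 2 * k + 1; have D0 : 0 < D by rewrite /D; lra.
have [n0 hn] := geometric_small th (e / D) th01 (divr_gt0 e0 D0).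
have {hn} := hn n0 (leqnn _); rewrite ler_pdivlMr// => thD.
have th0 : 0 <= th ^+ n0 by rewrite exprn_ge0//; case/andP: th01 => /ltW.
exists (fun z => (\sum_(k < n0) u z ^+ k) * g z), ((\sum_(k < n0) U ^+ k) * G).
split; first by apply: is_laurentM => //; exact: is_laurent_geometric.
  move=> z /zP[zb0 zg uth zbc].
  have -> : (\sum_(k < n0) u z ^+ k) * g z - (z - b)^-1 = - (u z ^+ n0 * (z - b)^-1).
    have geo : (1 - u z) * (\sum_(k < n0) u z ^+ k) = 1 - u z ^+ n0.
      by rewrite -[1 - u z]opprB mulNr -subrX1 opprB.
    apply: (mulfI zb0); rewrite mulrBr mulrCA mulrC zg mulrN mulrCA divff//.
    by rewrite geo; ring.
  rewrite cnormN cnormM cnormX.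
  have h1 : cnorm (u z) ^+ n0 <= th ^+ n0.
    by rewrite lerXn2r ?nnegrE ?cnorm_ge0// (le_trans (cnorm_ge0 _) uth).
  apply: le_trans (ler_pM _ _ h1 zbc) _; rewrite ?exprn_ge0 ?cnorm_ge0//.
  by move: thD; rewrite /D; nra.
move=> x.
have -> : (\sum_(k < n0) U ^+ k) * G - (A - b%:M)^-1 = - (U ^+ n0 * (A - b%:M)^-1).
  apply: (mulIr unit); rewrite mulrBl mulNr -!mulrA GU geoU mulVr// mulr1.
  by rewrite addrAC subrr add0r.
rewrite mulNmx vnN -mulmxE -mulmxA; apply: le_trans (Upow _ _) _.
have h1 : 2 * th ^+ n0 * vn ((A - b%:M)^-1 *m x) <= 2 * th ^+ n0 * (k * vn x).
  by rewrite ler_wpM2l// mulr_ge0.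
apply: le_trans h1 _; rewrite mulrA ler_wpM2r ?vn_ge0//.
by move: thD; rewrite /D; nra.
Qed.

Lemma poly_bounded_on_circles (p : {poly R[i]}) :
  exists2 c : R, 0 <= c & forall z, on_circles t z -> cnorm p.[z] <= c.
Proof.
pose s := Num.max t t^-1.
exists (\sum_(i < size p) cnorm p`_i * s ^+ i).
  apply: sumr_ge0 => i _; rewrite mulr_ge0 ?cnorm_ge0// exprn_ge0//.
  by rewrite le_max (ltW t0).
move=> z zt; rewrite horner_coef; apply: le_trans (cnorm_sum _ _ _ _) _.
apply: ler_sum => i _; rewrite cnormM ler_wpM2l ?cnorm_ge0// cnormX.
rewrite lerXn2r ?nnegrE ?cnorm_ge0 ?le_max ?(ltW t0)//.
by case: zt => ->; rewrite lexx ?orbT.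
Qed.

Lemma approximable_poly (p : {poly R[i]}) :
  approximable (fun z => p.[z]) (horner_mx A p).
Proof.
split; first exact: poly_bounded_on_circles.
move=> e e0; exists (fun z => p.[z]), (horner_mx A p); split.
- exists p, 0%N; split; last by rewrite /laurent_mx expr0 mulr1.
  by move=> z _; rewrite expr0 divr1.
- by move=> z _; rewrite subrr cnorm0 ltW.
by move=> x; rewrite subrr mul0mx vn0 mulr_ge0 ?vn_ge0 ?ltW.
Qed.

End Approximation.

(** * Rational functions and the limit radius *)

Section RationalFunctions.
Context {R : realType} {d : nat}.
Variables (A : 'M[R[i]]_d.+1) (t R1 rho : R).
Hypothesis Aunit : A \is a GRing.unit.
Hypothesis R10 : 0 < R1.
Hypothesis R1t : R1 < t.
Hypothesis t1 : 1 < t.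
Hypothesis trho : t < rho.
Hypothesis wA : forall x, cnorm (ip (A *m x) x) <= R1 * vn x ^+ 2.
Hypothesis wAV : forall x, cnorm (ip (A^-1 *m x) x) <= R1 * vn x ^+ 2.

Let t0 : 0 < t. Proof. exact: lt_trans R1t. Qed.
Let rho0 : 0 < rho. Proof. exact: lt_trans trho. Qed.
Let th01 : 0 < t / rho < 1.
Proof. by rewrite divr_gt0//= ltr_pdivrMr// mul1r. Qed.

Let scaled_power B (c : R[i]) n (x : 'cV_d.+1) : cnorm c <= rho^-1 ->
    (forall x, cnorm (ip (B *m x) x) <= R1 * vn x ^+ 2) ->
  vn ((c%:M * B) ^+ n *m x) <= 2 * (t / rho) ^+ n * vn x.
Proof.
move=> c1 wB; rewrite -[_ * B]/(_ *m B) mul_scalar_mx exprZn -scalemxAl vnZ cnormX.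
apply: le_trans (ler_wpM2l _ (vn_power_le B R1 R10 wB n x)) _.
  by rewrite exprn_ge0 ?cnorm_ge0.
have h : (cnorm c * R1) ^+ n <= (t / rho) ^+ n.
  have h : cnorm c * R1 <= t / rho.
    by rewrite mulrC ler_pM ?cnorm_ge0 ?(ltW R10) ?(ltW R1t).
  by rewrite lerXn2r ?nnegrE ?(le_trans _ h)// mulr_ge0 ?cnorm_ge0 ?(ltW R10).
by rewrite exprMn in h; have := ler_wpM2r (vn_ge0 x) h; lra.
Qed.

(** Expand [1 / (z - b)] in powers of [z / b] or of [b / z], according to the
    side of the annulus on which the pole lies. *)
Lemma approximable_inv_linear (b : R[i]) : cnorm b <= rho^-1 \/ rho <= cnorm b ->
  A - b%:M \is a GRing.unit /\ approximable A t (fun z => (z - b)^-1) (A - b%:M)^-1.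
Proof.
have Vt : t^-1 < t by apply: lt_trans t1; rewrite invf_lt1.
have dist (z w : R[i]) (e : R) : 0 < e -> cnorm w + e <= cnorm z ->
    z - w != 0 /\ cnorm (z - w)^-1 <= e^-1.
  move=> e0 h; have zw : e <= cnorm (z - w).
    by have := cnormD (z - w) w; rewrite subrK; lra.
  have zw0 : 0 < cnorm (z - w) by apply: lt_le_trans zw.
  by split; rewrite -?cnorm_gt0// cnormV lef_pV2.
case=> hb.
  have rV : 0 < t^-1 - rho^-1 by rewrite subr_gt0 ltf_pV2.
  apply: (approximable_geometric A t Aunit t0 b (fun z => b * z^-1) (fun z => z^-1)
     (b%:M * A^-1) A^-1 (t / rho) (t^-1 - rho^-1)^-1) => //.
  - exact: (is_laurentM A t (fun=> b) (fun z => z^-1) _ _ (is_laurentC A t b) (is_laurentV A t)).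
  - exact: is_laurentV.
  - by rewrite invr_ge0 ltW.
  - move=> z zt; have z0 := on_circles_neq0 t t0 z zt.
    have zV : t^-1 <= cnorm z by case: zt => ->//; exact: ltW.
    have [h1 h2] : z - b != 0 /\ cnorm (z - b)^-1 <= (t^-1 - rho^-1)^-1.
      by apply: dist => //; lra.
    split=> //; first by rewrite mulrBl divff.
    rewrite cnormM cnormV mulrC ler_pM ?cnorm_ge0 ?invr_ge0 ?cnorm_ge0//.
    by rewrite invf_ple ?posrE ?cnorm_gt0.
  - by rewrite mulrBr mulVr// -[A^-1 * _]/(A^-1 *m _) scalar_mxC.
  by move=> n x; apply: scaled_power.
have b0 : b != 0 by rewrite -cnorm_gt0; apply: lt_le_trans hb.
have rt : 0 < rho - t by rewrite subr_gt0.
apply: (approximable_geometric A t Aunit t0 b (fun z => b^-1 * z) (fun=> - b^-1)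
     (b^-1%:M * A) (- b^-1)%:M (t / rho) (rho - t)^-1) => //.
- exact: (is_laurentM A t (fun=> b^-1) id _ _ (is_laurentC A t b^-1) (is_laurentX A t)).
- exact: is_laurentC.
- by rewrite invr_ge0 ltW.
- move=> z zt; have zV : cnorm z <= t by case: zt => ->//; exact: ltW.
  have [h1 h2] : b - z != 0 /\ cnorm (b - z)^-1 <= (rho - t)^-1 by apply: dist => //; lra.
  have h3 : z - b != 0 by rewrite -opprB oppr_eq0.
  split=> //; first by field.
    rewrite cnormM cnormV mulrC ler_pM ?cnorm_ge0 ?invr_ge0 ?cnorm_ge0//.
    by rewrite lef_pV2 ?posrE ?cnorm_gt0.
  by rewrite -opprB invrN cnormN.
- rewrite mulrBr -[_%:M * b%:M]/(_ *m _) -scalar_mxM mulNr mulVf//.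
  by rewrite raddfN mulNr raddfN /= opprK addrC.
move=> n x; apply: scaled_power => //.
by rewrite cnormV lef_pV2 ?posrE ?cnorm_gt0.
Qed.

Lemma approximable_rational (p : {poly R[i]}) (bs : seq R[i]) :
    (forall b, b \in bs -> cnorm b <= rho^-1 \/ rho <= cnorm b) ->
  let q := \prod_(b <- bs) ('X - b%:P) in
  horner_mx A q \is a GRing.unit /\
  approximable A t (fun z => p.[z] / q.[z]) (horner_mx A p * (horner_mx A q)^-1).
Proof.
elim: bs => [|b bs IHbs] bsP /=.
  rewrite big_nil rmorph1 unitr1 invr1 mulr1; split=> //.
  rewrite (_ : (fun z => _) = (fun z => p.[z])); first exact: approximable_poly.
  by apply/funext => z; rewrite hornerC divr1.
have [|qu qa] := IHbs; first by move=> c cbs; apply: bsP; rewrite inE cbs orbT.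
have [bu ba] := approximable_inv_linear b (bsP b (mem_head _ _)).
rewrite big_cons; set q := \prod_(b <- bs) _ in qu qa *.
have E : horner_mx A ('X - b%:P) = A - b%:M.
  by rewrite rmorphB /= horner_mx_X horner_mx_C.
rewrite rmorphM /= E; split; first by rewrite unitrM_comm ?bu//; rewrite -E /GRing.comm -!rmorphM mulrC.
rewrite invrM// mulrA.
rewrite (_ : (fun z => _) = (fun z => p.[z] / q.[z] * (z - b)^-1)).
  exact: approximableM.
by apply/funext => z; rewrite hornerM hornerXsubC invfM; ring.
Qed.

(** An approximant is bounded by [1 + e] on the circles; rescale it. *)
Lemma calculus_bound_approximable phi M (K : R) :
    (forall T x, calculus_ball A t 1 T -> vn (T *m x) <= K * vn x) ->
    approximable A t phi M ->
    (forall z, on_circles t z -> cnorm (phi z) <= 1) ->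
  forall x, vn (M *m x) <= K * vn x.
Proof.
move=> TK [_ phiM] phi1 x.
have h01 : 0 < (2^-1 : R) < 1 by rewrite invr_gt0 invf_lt1 ?ltr0n ?ltr1n.
apply: (@le_geometric _ 2^-1 _ _ ((K + 1) * vn x) 0%N) => // n _.
have : 0 < (2^-1 : R) ^+ n by rewrite exprn_gt0// invr_gt0.
set e := _ ^+ n => e0.
have [psi [N [[p [m [pE ->]]] psiphi NM]]] := phiM e e0.
have e1 : 0 < 1 + e by lra.
have ball : calculus_ball A t 1 ((1 + e)^-1%:C *: laurent_mx A p m).
  have ce : cnorm (1 + e)^-1%:C = (1 + e)^-1 by rewrite cnorm_ge0_real// invr_ge0 ltW.
  suff h : calculus_ball A t (1 + e) (laurent_mx A p m).
    by have := calculus_ballZ A t _ (1 + e)^-1%:C _ h; rewrite ce mulVf ?gt_eqF.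
  exists p, m; split=> // z zt.
  have z0 := on_circles_neq0 t t0 z zt.
  rewrite -cnormX -ler_pdivrMr ?cnorm_gt0 ?expf_neq0// -cnormV -cnormM -pE//.
  have := cnormD (psi z - phi z) (phi z); rewrite subrK.
  by have := psiphi z zt; have := phi1 z zt; lra.
have := TK _ x ball.
rewrite -scalemxAl vnZ cnorm_ge0_real ?invr_ge0 ?(ltW e1)// ler_pdivrMl// => h.
have := NM x; rewrite mulmxBl => h2.
have := vnB (laurent_mx A p m *m x) (laurent_mx A p m *m x - M *m x).
by rewrite subKr; lra.
Qed.

Lemma annulus_bound : exists2 K : R,
  (forall T x, calculus_ball A t 1 T -> vn (T *m x) <= K * vn x) &
  K <= 2 + Num.sqrt (4 + 2 / (t ^+ 2 + 1)).
Proof.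
pose r := t^-1 ^+ 2; pose de := 2 * r / (1 + r).
have ti : 0 < t^-1 < 1 by rewrite invr_gt0 t0 invf_lt1.
have r01 : 0 < r < 1.
  by case/andP: ti => a b; rewrite exprn_gt0//= exprn_ilt1// ltW.
have /andP[r0 r1] := r01; have r10 : 0 < 1 + r by lra.
have de03 : 0 < de <= 3.
  apply/andP; split; first exact: divr_gt0 (mulr_gt0 (ltr0n R 2) r0) r10.
  by rewrite /de ler_pdivrMr//; lra.
have deE : de = 2 / (t ^+ 2 + 1).
  have tt : 0 < t ^+ 2 + 1 by rewrite addr_gt0 ?exprn_gt0.
  by rewrite /de /r; field; rewrite !gt_eqF//= addrC.
have [K TK Kde] := extremal_bound (calculus_ball A t) _ de de03 (calculus_ball1 A t)
  (calculus_ballZ A t) (calculus_ballM A t) (fun T a => calculus_ball_mobius A t Aunit t0 T a)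
  (calculus_ball_le A t R1 Aunit R10 R1t wA wAV)
  (fun T => duality A t R1 Aunit R10 R1t wA wAV T r01).
exists K => //; rewrite -deE; have := sqrtr_ge0 (4 + de).
case: Kde => Kde s0; first by lra.
rewrite -lerBlDl; apply: le_trans (ler_norm _) _; rewrite -sqrtr_sqr.
by apply: ler_wsqrtr; lra.
Qed.

Lemma ratfun_bound (p q : {poly R[i]}) x :
    bounded_by_one_on_annulus rho p q ->
  vn (ratfun_mx p q A *m x) <= (2 + Num.sqrt (4 + 2 / (t ^+ 2 + 1))) * vn x.
Proof.
move=> pq.
have Vt : t^-1 < t by apply: lt_trans t1; rewrite invf_lt1.
have Vr : rho^-1 < t^-1 by rewrite ltf_pV2.
have ann z : on_circles t z -> annulus rho z.
  rewrite /annulus /= -cnormE => -[->|->]; apply/andP; split=> //.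
    exact: lt_trans Vt.
  exact: lt_trans trho.
have [bs qE] := closed_field_poly_normal q.
have q0 : q != 0.
  apply/eqP => q0; have /ann/pq[] : on_circles t t%:C.
    by left; rewrite cnorm_ge0_real// ltW.
  by rewrite q0 horner0 eqxx.
have lc0 : lead_coef q != 0 by rewrite lead_coef_eq0.
have bsP b : b \in bs -> cnorm b <= rho^-1 \/ rho <= cnorm b.
  move=> bbs; have qb : q.[b] = 0.
    apply/eqP; rewrite -[_ == 0]/(root q b) qE rootZ// root_prod_XsubC//.
  have [h|h] := leP (cnorm b) rho^-1; first by left.
  have [h'|h'] := leP rho (cnorm b); first by right.
  have /pq[] : annulus rho b by rewrite /annulus /= -cnormE h.
  by rewrite qb eqxx.
have [qu qa] := approximable_rational ((lead_coef q)^-1 *: p) bs bsP.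
set Q := \prod_(b <- bs) _ in qu qa qE.
have [K TK Kle] := annulus_bound.
have -> : ratfun_mx p q A = horner_mx A ((lead_coef q)^-1 *: p) * (horner_mx A Q)^-1.
  rewrite /ratfun_mx [in invmx _]qE !horner_mxZ -[invmx _]/((_ : 'M_d.+1)^-1).
  by rewrite invrZ ?unitfE// -scalemxAr -scalerAl.
apply: le_trans (calculus_bound_approximable _ _ K TK qa _ x) _.
  move=> z /ann/pq[_]; rewrite -cnormE [in q.[z]]qE !hornerZ invfM => h.
  by apply: le_trans h; rewrite le_eqVlt; apply/orP; left; apply/eqP; congr cnorm; ring.
by rewrite ler_wpM2r ?vn_ge0.
Qed.

End RationalFunctions.

Section Suprema.
Context {R : realType} {d : nat}.
Implicit Types (M : 'M[R[i]]_d.+1).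

Lemma numradius_bound M x : cnorm (ip (M *m x) x) <= numradius M * vn x ^+ 2.
Proof.
have [x0|x0] := eqVneq (vn x) 0.
  by rewrite (vn0_eq0 _ x0) ip0r cnorm0 vn0 expr0n mulr0.
have xp : 0 < vn x by rewrite lt_def x0 vn_ge0.
have cx : cnorm (vn x)^-1%:C = (vn x)^-1 by rewrite cnorm_ge0_real// invr_ge0 ltW.
pose y := (vn x)^-1%:C *: x.
have y1 : vn y = 1 by rewrite vnZ cx mulVf.
have : cnorm (ip (M *m y) y) <= numradius M.
  rewrite /numradius; apply: ub_le_sup.
    have [c c0 Mc] := mx_bounded M.
    exists c => _ [z /= z1 <-].
    have z1' : vn z <= 1 by rewrite vn.unlock.
    rewrite -cnormE -[inner _ _]/(inner (M *m z) z).
    have <- : ip (M *m z) z = inner (M *m z) z by rewrite ip.unlock.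
    apply: le_trans (ip_CauchySchwarz _ _) _.
    apply: le_trans (ler_pM (vn_ge0 _) (vn_ge0 _) (Mc z) z1') _.
    by rewrite mulr1 ler_piMr.
  exists y => /=; first by rewrite -[vnorm y]/(vnorm y) -vnormE y1.
  by rewrite cnormE ip.unlock.
rewrite -scalemxAr ipZl ipZr cconj_real !cnormM cx mulrA -expr2 exprVn.
by rewrite ler_pdivrMl ?exprn_gt0// mulrC.
Qed.

Lemma opnorm_le M (K : R) : 0 <= K -> (forall x, vn (M *m x) <= K * vn x) ->
  opnorm M <= K.
Proof.
move=> K0 MK; rewrite /opnorm; apply: ge_sup.
  exists (vnorm (M *m 0)), 0 => //=.
  by rewrite -[vnorm 0]/(vnorm 0) -vnormE vn0.
move=> _ [x /= x1 <-]; rewrite -vnormE; rewrite -vnormE in x1.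
by apply: le_trans (MK x) _; rewrite ler_piMr.
Qed.

End Suprema.

(** The bound is continuous in the radius.  In the form
    [((a - 2)^2 - 4) (t^2 + 1) <= 2] it is a polynomial inequality, which passes
    to the limit explicitly. *)
Lemma le_sqrt_limit {R : realType} (rho T a : R) : 1 < rho -> T < rho ->
    (forall t, T < t -> 1 < t -> t < rho ->
       a <= 2 + Num.sqrt (4 + 2 / (t ^+ 2 + 1))) ->
  a <= 2 + Num.sqrt (4 + 2 / (rho ^+ 2 + 1)).
Proof.
move=> rho1 Trho h; rewrite leNgt; apply/negP => ha.
have rho0 : 0 < rho by lra.
have pos (t : R) : 0 < t ^+ 2 + 1 by have := sqr_ge0 t; lra.
have arg (t : R) : 0 <= 4 + 2 / (t ^+ 2 + 1).
  by rewrite addr_ge0// divr_ge0// ltW.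
pose X := (a - 2) ^+ 2 - 4.
have a2 : 0 < a - 2 by have := sqrtr_ge0 (4 + 2 / (rho ^+ 2 + 1)); lra.
have X1 : 2 < X * (rho ^+ 2 + 1).
  rewrite -ltr_pdivrMr// /X ltrBrDl -[ltLHS]sqr_sqrtr//.
  by rewrite ltr_pXn2r ?nnegrE ?sqrtr_ge0 ?(ltW a2)//; lra.
have X2 t : T < t -> 1 < t -> t < rho -> X * (t ^+ 2 + 1) <= 2.
  move=> t1 t2 t3; rewrite -ler_pdivlMr// /X lerBlDl -[leRHS]sqr_sqrtr//.
  by rewrite ler_pXn2r ?nnegrE ?sqrtr_ge0 ?(ltW a2)//; have := h t t1 t2 t3; lra.
have Xp : 0 < X by have := pos rho; nra.
pose g := X * (rho ^+ 2 + 1) - 2; have g0 : 0 < g by rewrite subr_gt0.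
pose t1 := Num.max (Num.max T 1) (rho - g / (2 * rho * X)).
have den : 0 < 2 * rho * X by rewrite !mulr_gt0.
have t1rho : t1 < rho.
  by rewrite !gt_max Trho rho1 gtrBl divr_gt0.
pose t := (t1 + rho) / 2.
have tt1 : t1 < t by rewrite /t; lra.
have trho : t < rho by rewrite /t; lra.
have Tt : T < t by apply: le_lt_trans tt1; rewrite !le_max lexx.
have ot : 1 < t by apply: le_lt_trans tt1; rewrite !le_max lexx orbT.
have gt : rho - g / (2 * rho * X) < t.
  by apply: le_lt_trans tt1; rewrite !le_max lexx !orbT.
have {}gt : (rho - t) * (2 * rho * X) < g by rewrite -ltr_pdivlMr//; lra.
have := X2 t Tt ot trho.
have : (rho - t) * (rho + t) * X <= (rho - t) * (2 * rho * X).
  rewrite -mulrA ler_pM2l ?subr_gt0// ler_pM2r//; lra.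
by move: gt; rewrite /g; lra.
Qed.

Theorem mainTheorem2 (R : realType) (rho : R) (d : nat) (A : 'M[R[i]]_d.+1)
    (hrho : 1 < rho)
    (hA : A \in unitmx)
    (hwA : numradius A < rho)
    (hwAinv : numradius (invmx A) < rho) :
  (Kconst A rho <= (2 + Num.sqrt (4 + 2 / (rho ^+ 2 + 1)))%:E)%E.
Proof.
apply: ereal_inf_lbound; exists (2 + Num.sqrt (4 + 2 / (rho ^+ 2 + 1))) => //.
move=> p q pq; apply: opnorm_le => [|x]; first by rewrite addr_ge0// sqrtr_ge0.
have [x0|x0] := eqVneq (vn x) 0.
  by rewrite (vn0_eq0 _ x0) mulmx0 vn0 mulr0.
have xp : 0 < vn x by rewrite lt_def x0 vn_ge0.
rewrite -ler_pdivrMr//.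
have [w w_rho wA] : exists2 w, w < rho &
    forall y, cnorm (ip (A *m y) y) <= w * vn y ^+ 2.
  by exists (numradius A); last exact: numradius_bound.
have [w' w'_rho wAV] : exists2 w, w < rho &
    forall y, cnorm (ip (invmx A *m y) y) <= w * vn y ^+ 2.
  by exists (numradius (invmx A)); last exact: numradius_bound.
pose T := Num.max 1 (Num.max w w').
have T0 : 0 < T by rewrite lt_max ltr01.
have Trho : T < rho by rewrite !gt_max hrho w_rho w'_rho.
have wT : w <= T by rewrite !le_max lexx orbT.
have w'T : w' <= T by rewrite !le_max lexx !orbT.
apply: (le_sqrt_limit rho T _ hrho Trho) => t Tt t1 trho.
rewrite ler_pdivrMr//.
apply: (ratfun_bound A t T rho hA T0 Tt t1 trho _ _ p q x pq) => y.
  by apply: le_trans (wA y) _; rewrite ler_wpM2r ?sqr_ge0.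
by apply: le_trans (wAV y) _; rewrite ler_wpM2r ?sqr_ge0.
Qed.
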